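(* Let $d\in\mathbb{N}$ and let $A=(A_1,\dots,A_d)$ be the $q$-Gaussians on $\mathcal{F}_q(H)$, $\dim H=d$. For any $-1<q<1$, a free Gibbs potential exists for the $q$-Gaussians; that is, there exists an operator $V\in W^*(A_1,\dots,A_d)$ such that $\mathcal{D}_iV=\xi_i$ for all $i\in[d]$, where $(\xi_1,\dots,\xi_d)$ is the conjugate system of $A$ and $\mathcal{D}_i$ are the cyclic derivatives.
   Context: **$q$-Gaussians.** Let $-1<q<1$, $[d]=\{1,\dots,d\}$, and let $H$ be a $d$-dimensional complex Hilbert space with orthonormal basis $e_1,\dots,e_d$. Let $[d]^*$ be the set of finite words in $[d]$, with length $|w|$. The algebraic Fock space is $\mathcal{F}_{\mathrm{alg}}(H)=\bigoplus_{n\ge0}H^{\otimes n}$ (algebraic direct sum), $H^{\otimes0}=\mathbb{C}e_0$, with linear basis $e_w=e_{w_1}\otimes\cdots\otimes e_{w_n}$, $w=w_1\cdots w_n\in[d]^*$ (with $e_0$ corresponding to the empty word). The inner product $\langle\xi,\eta\rangle_q=\langle\xi,\bigoplus_nP^{(n)}\eta\rangle$, with $P^{(n)}e_w=\sum_{\pi\in S_n}q^{|\pi|}e_{w_{\pi(1)}\cdots w_{\pi(n)}}$ for $|w|=n$ and $|\pi|$ the number of inversions, is strictly positive; $\mathcal{F}_q(H)$ is the completion. The $q$-Gaussians are $A_i=l_i+l_i^*\in B(\mathcal{F}_q(H))$ with $l_i^*e_w=e_{iw}$ and $l_i$ the adjoint of $l_i^*$. $W^*(A)$ is the von Neumann algebra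 generated by $A$; $\tau_q(T)=\langle Te_0,e_0\rangle_q$ is a faithful normal trace on it, and $T\mapsto Te_0$ identifies $L^2(W^*(A),\tau_q)$ with $\mathcal{F}_q(H)$. For $w=w_1\cdots w_n$ put $A^w=A_{w_1}\cdots A_{w_n}$. **Conjugate system.** The free difference quotients $\partial_i:\mathbb{C}\langle x_1,\dots,x_d\rangle\to\mathbb{C}\langle x_1,\dots,x_d\rangle^{\otimes2}$ are determined by the Leibniz rule and $\partial_ix_j=\delta_{ij}1\otimes1$. The conjugate system of $A$ is the unique tuple $(\xi_1,\dots,\xi_d)\in\mathcal{F}_q(H)^d$ with $\langle Q(A)\xi_i,e_0\rangle_q=(\tau_q\otimes\tau_q)[(\partial_iQ)(A)]$ for all $Q\in\mathbb{C}\langle x_1,\dots,x_d\rangle$, $i\in[d]$. It exists for all $-1<q<1$ and each $\xi_i$ is of the form $X_ie_0$ with $X_i\in W^*(A)$; $\xi_i$ is identified with the operator $X_i$. **Cyclic derivatives.** $\mathcal{D}_i=m_{\mathrm{flip}}\circ\partial_i$, where $m_{\mathrm{flip}}(a\otimes b)=ba$. For $V$ given by a noncommutative power series $V=\sum_{w\in[d]^*}\beta_wA^w$ with $\sum_w|\beta_w|R^{|w|}<\infty$ for some $R>\max_i\|A_i\|$, $\mathcal{D}_iV$ is understood termwise: $\mathcal{D}_iV=\sum_w\beta_w(\mathcal{D}_ix^w)(A)$, where $x^w=x_{w_1}\cdots x_{w_n}$. *)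

(* Defs.v *)
From HB Require Import structures.
From mathcomp Require Import all_boot all_order all_algebra all_fingroup.
From mathcomp Require Import sesquilinear finmap complex.
From mathcomp Require Import all_classical all_reals all_analysis.

Set Implicit Arguments.
Unset Strict Implicit.
Unset Printing Implicit Defensive.

Import Order.TTheory GRing.Theory Num.Theory numFieldNormedType.Exports.

Local Open Scope classical_set_scope.
Local Open Scope ring_scope.
Local Open Scope complex_scope.

Notation word d := (seq 'I_d).

(** Finitely supported families of complex numbers indexed by words.  This is
    both the algebraic Fock space (coordinates in the basis [e_w]) and the
    space of noncommutative polynomials (coordinates in the monomials [x^w]). *)
Definition wordcomb (R : realType) (d : nat) : Type :=
  {fsfun word d -> R[i] with 0}.

Definition lincomb (R : realType) (d : nat) (V : lmodType R[i])
    (p : wordcomb R d) (v : word d -> V) : V :=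
  \sum_(w <- finsupp p) p w *: v w.

(** [\partial_i x^w], a sum of pure tensors [x^u \otimes x^v], given as the list
    of the pairs [(u, v)]; the recursion is
    [\partial_i (x_j P) = \delta_ij (1 \otimes P) + (x_j \otimes 1) \partial_i P]. *)
Fixpoint free_diff (d : nat) (i : 'I_d) (w : word d) : seq (word d * word d) :=
  if w is j :: w' then
    (if j == i then [:: ([::], w')] else [::])
      ++ [seq (j :: p.1, p.2) | p <- free_diff i w']
  else [::].

(** [\mathcal{D}_i x^w], a sum of monomials given as the list of their words. *)
Definition cyc_diff (d : nat) (i : 'I_d) (w : word d) : seq (word d) :=
  [seq p.2 ++ p.1 | p <- free_diff i w].

Definition inversions (n : nat) (s : 'S_n) : nat :=
  #|[pred p : 'I_n * 'I_n | (p.1 < p.2)%N && (s p.2 < s p.1)%N]|.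

Definition perm_word (d : nat) (w : word d) (s : 'S_(size w)) : word d :=
  [seq tnth (in_tuple w) (s k) | k <- enum 'I_(size w)].

(** The coordinate along [e_v] of the image of [eta] under the direct sum of the
    operators [P^(n)]. *)
Definition q_symmetrize (R : realType) (d : nat) (q : R) (eta : wordcomb R d)
    (v : word d) : R[i] :=
  \sum_(w <- finsupp eta)
    eta w * \sum_(s : 'S_(size w) | v == perm_word s) (q ^+ inversions s)%:C.

Definition q_inner (R : realType) (d : nat) (q : R) (xi eta : wordcomb R d) :
    R[i] :=
  \sum_(v <- finsupp xi) xi v * Num.conj (q_symmetrize q eta v).

(** A Hilbert space is a complete normed module over [R[i]] with a form
    [{dot F for Num.conj}] (linear in the first variable) inducing its norm. *)

Definition induces_norm (R : realType) (F : normedModType R[i])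
    (dot : {dot F for Num.conj}) : Prop :=
  forall x : F, `|x| ^+ 2 = dot x x.

Section Operators.
Variables (R : realType) (F : normedModType R[i]) (dot : {dot F for Num.conj}).
Implicit Types (S T : F -> F) (M : set (F -> F)).

Definition bounded_op T : Prop := linear T /\ continuous T.

(** Norms in a normed module over [R[i]] take values in [R[i]], hence [Re].
    As a [sup], this is meaningful for bounded operators only. *)
Definition opnorm T : R :=
  sup [set complex.Re `|T x| | x in [set x : F | `|x| <= 1]].

Definition adjoint_ops S T : Prop := forall x y : F, dot (S x) y = dot x (T y).

Definition commutant M : set (F -> F) :=
  [set T | bounded_op T /\ forall S, M S -> T \o S = S \o T].

Definition vN_generated M : set (F -> F) :=
  commutant (commutant (M `|` [set T | exists2 S, M S & adjoint_ops S T])).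

End Operators.

(** [F], with the vectors [e w], is the completion of the algebraic Fock space
    for the q-inner product: the linear map sending [e_w] to [e w] is isometric
    with dense range. *)
Definition is_q_Fock (R : realType) (d : nat) (q : R)
    (F : completeNormedModType R[i]) (dot : {dot F for Num.conj})
    (e : word d -> F) : Prop :=
  [/\ induces_norm dot,
      forall xi eta : wordcomb R d,
        dot (lincomb xi e) (lincomb eta e) = q_inner q xi eta &
      dense (range (fun xi : wordcomb R d => lincomb xi e))].

(** [ls] is the creation operator (written [l_i^*]), [l] its adjoint. *)
Definition q_Gaussians (R : realType) (d : nat) (F : normedModType R[i])
    (dot : {dot F for Num.conj}) (e : word d -> F) (A : 'I_d -> F -> F) :
    Prop :=
  forall i, exists l ls : F -> F,
    [/\ bounded_op l /\ bounded_op ls,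
        forall w, ls (e w) = e (i :: w),
        adjoint_ops dot l ls &
        A i = l \+ ls].

Section ConjugateSystem.
Variables (R : realType) (d : nat) (F : normedModType R[i]).
Variables (dot : {dot F for Num.conj}) (e : word d -> F) (A : 'I_d -> F -> F).

Definition vacuum : F := e [::].

Definition tau (T : F -> F) : R[i] := dot (T vacuum) vacuum.

Definition monomial (w : word d) : F -> F :=
  foldr (fun i (T : F -> F) => A i \o T) idfun w.

Definition poly_op (Q : wordcomb R d) : F -> F :=
  fun x => lincomb Q (fun w => monomial w x).

(** [(\tau \otimes \tau) [(\partial_i Q)(A)]] *)
Definition tau2_diff (i : 'I_d) (Q : wordcomb R d) : R[i] :=
  \sum_(w <- finsupp Q)
    Q w * \sum_(p <- free_diff i w) tau (monomial p.1) * tau (monomial p.2).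

Definition conjugate_system (xi : 'I_d -> F) : Prop :=
  forall (Q : wordcomb R d) (i : 'I_d),
    dot (poly_op Q (xi i)) vacuum = tau2_diff i Q.

(** [T = \sum_w beta_w B_w], converging in operator norm when the terms are
    summed by increasing length of [w]. *)
Definition op_series (beta : word d -> R[i]) (B : word d -> F -> F)
    (T : F -> F) : Prop :=
  bounded_op T /\
  (fun N : nat => opnorm (fun x => T x -
     \sum_(n < N) \sum_(w : n.-tuple 'I_d) beta w *: B w x)) @ \oo --> (0 : R).

(** [beta] is absolutely summable at a radius larger than all [||A_i||]. *)
Definition convergent_series (beta : word d -> R[i]) : Prop :=
  exists2 r : R, \big[Num.max/0]_(i < d) opnorm (A i) < r &
    summable [set: word d]
      (fun w => (complex.Re `|beta w| * r ^+ size w)%:E).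

Definition power_series (beta : word d -> R[i]) (V : F -> F) : Prop :=
  convergent_series beta /\ op_series beta monomial V.

(** [D] is the termwise [i]-th cyclic derivative of [\sum_w beta_w A^w]. *)
Definition cyclic_derivative (i : 'I_d) (beta : word d -> R[i]) (D : F -> F) :
    Prop :=
  op_series beta (fun w x => \sum_(u <- cyc_diff i w) monomial u x) D.

Definition free_Gibbs_potential (X : 'I_d -> F -> F) (V : F -> F) : Prop :=
  vN_generated dot (range A) V /\
  exists2 beta, power_series beta V & forall i, cyclic_derivative i beta (X i).

End ConjugateSystem.

(* Main.v *)
(** For a word [v] of length [k] put [c_k = (-1)^k q^(k(k+1)/2)].  The operators
    [D_i e_w = sum_(w = u i v) c_|v| r_(v_1) ... r_(v_k) e_u], built from the right
    annihilation operators [r_j], satisfy [D_i A_j = A_j D_i + delta_ij P] with [P]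
    the projection onto the vacuum; hence [phi_i(e_w) = <D_i e_w, e_0>] is the
    functional that represents the conjugate variable [xi_i].  Its component of
    degree [n] is at most [C^n |q|^(n^2/8)], while Zagier's factorization shows that
    the inverse of the q-symmetrizer [P^(n)] and the coefficients of the Wick
    polynomials grow only exponentially in [n].  So [xi_i = sum_u b(iu) A^u] with
    [b] summable at every radius.  Finally [sum_i (A_i - right A_i) xi_i = 0] by
    traciality, and this identity holds coefficientwise up to terms of high degree,
    which forces [b] to be invariant under rotation of words; therefore
    [V = sum_w b(w)/|w| A^w] has cyclic derivatives [xi_i]. *)

Require Import Defs.
From HB Require Import structures.
From mathcomp Require Import all_boot all_order all_algebra all_fingroup.
From mathcomp Require Import sesquilinear finmap complex.
From mathcomp Require Import all_classical all_reals all_analysis.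
From mathcomp Require Import ring lra zify.

Set Implicit Arguments.
Unset Strict Implicit.
Unset Printing Implicit Defensive.
Import Order.TTheory GRing.Theory Num.Theory numFieldNormedType.Exports.
Local Open Scope classical_set_scope.
Local Open Scope ring_scope.

(** * Operators on the algebraic Fock space *)

(** The weights [c_k] are forced. When a product of [r]s meets the letter that [A_j] has just
    created, one [r] may absorb it, at the price of a power of [q]; [c_k = - q^k c_(k-1)] makes this
    cancel against the letter that the annihilation part of [A_j] removes from [v]. On the vacuum
    functional only the cuts [w = u i v] with [|u| = |v|] survive, whence the Gaussian decay. It
    absorbs, for every [|q| < 1], the losses per degree from inverting the symmetrizer, counting
    words and passing to Wick polynomials. The delicate point is rotation invariance. An identity of
    vectors between infinite series in the [A^u] does not by itself identify coefficients, since
    independence of the monomials concerns finite sums. So the commutator identity is used degree by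
    degree and tested on the functional that reads off one Wick coefficient: creation terms from
    degree [n] cancel annihilation terms from degree [n + 2], and after truncation two boundary
    terms of order [2^-N] remain. *)

Section FockOperators.
Variables (K : comNzRingType) (d : nat) (q : K).

(* An operator [T] on the algebraic Fock space is represented by its transpose:
   [f : word d -> V] stands for the linear map [e_w |-> f w], and the transpose
   of [T] maps [f] to [w |-> f (T e_w)].  So [lann j] and [rann j] are the left
   and right annihilations of the letter [j], [gauss j] and [rgauss j] the left
   and right actions of [A_j], and [moment u f] is [f] at [A^u e_0]. *)
Section Module.
Variable V : lmodType K.
Implicit Types (f g : word d -> V) (i j a : 'I_d) (u v w : word d).

Fixpoint lann j f w : V :=
  if w is a :: w' then f w' *+ (a == j) + q *: lann j (fun v => f (a :: v)) w'
  else 0.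

Fixpoint rann j f w : V :=
  if w is a :: w' then
    q ^+ size w' *: f w' *+ (a == j) + rann j (fun v => f (a :: v)) w'
  else 0.

Definition gauss j f w : V := f (j :: w) + lann j f w.
Definition rgauss j f w : V := f (rcons w j) + rann j f w.

Fixpoint moment u f : V := if u is j :: u' then moment u' (gauss j f) else f [::].

(** The free difference quotient [\partial_i x^w], with [h u v] in place of the tensor of [x^u] and
    [x^v]. *)
Fixpoint split_sum i (h : word d -> word d -> V) w : V :=
  if w is a :: w' then h [::] w' *+ (a == i) + split_sum i (fun u v => h (a :: u) v) w'
  else 0.

Lemma eq_lann j f g w : (forall v, (size v).+1 = size w -> f v = g v) ->
  lann j f w = lann j g w.
Proof.
elim: w f g => //= a w IH f g e.
rewrite e //; congr (_ + _ *: _); apply: IH => v /= hv; apply: e; by rewrite /= hv.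
Qed.

Lemma eq_rann j f g w : (forall v, (size v).+1 = size w -> f v = g v) ->
  rann j f w = rann j g w.
Proof.
elim: w f g => //= a w IH f g e.
rewrite e //; congr (_ + _); apply: IH => v /= hv; apply: e; by rewrite /= hv.
Qed.

Lemma eq_split_sum i h h' w :
  (forall u v, (size u + size v).+1 = size w -> h u v = h' u v) ->
  split_sum i h w = split_sum i h' w.
Proof.
elim: w h h' => //= a w IH h h' e.
rewrite e //; congr (_ + _); apply: IH => u v /= huv; apply: e; by rewrite /= addSn huv.
Qed.

Lemma lannD j f g w : lann j (fun v => f v + g v) w = lann j f w + lann j g w.
Proof.
elim: w f g => [|a w IH] f g /=; first by rewrite addr0.
by rewrite IH scalerDr mulrnDl addrACA.
Qed.

Lemma rannD j f g w : rann j (fun v => f v + g v) w = rann j f w + rann j g w.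
Proof.
elim: w f g => [|a w IH] f g /=; first by rewrite addr0.
by rewrite IH scalerDr mulrnDl addrACA.
Qed.

Lemma split_sumD i h h' w :
  split_sum i (fun u v => h u v + h' u v) w = split_sum i h w + split_sum i h' w.
Proof.
elim: w h h' => [|a w IH] h h' /=; first by rewrite addr0.
by rewrite IH mulrnDl addrACA.
Qed.

End Module.

Section Morphism.
Variables (V V' : lmodType K) (phi : {linear V -> V'}).
Implicit Types (f g : word d -> V) (j : 'I_d) (w : word d).

Lemma lann_linear j f w : lann j (fun v => phi (f v)) w = phi (lann j f w).
Proof.
by elim: w f => [|a w IH] f /=; rewrite ?linear0 // linearD linearZZ raddfMn IH.
Qed.

Lemma rann_linear j f w : rann j (fun v => phi (f v)) w = phi (rann j f w).
Proof.
by elim: w f => [|a w IH] f /=; rewrite ?linear0 // linearD raddfMn /= linearZZ IH.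
Qed.

Lemma split_sum_linear i (h : word d -> word d -> V) w :
  split_sum i (fun u v => phi (h u v)) w = phi (split_sum i h w).
Proof.
by elim: w h => [|a w IH] h /=; rewrite ?linear0 // linearD raddfMn IH.
Qed.

Lemma gauss_linear j f w : gauss j (fun v => phi (f v)) w = phi (gauss j f w).
Proof. by rewrite /gauss lann_linear linearD. Qed.

Lemma moment_linear u f : moment u (fun v => phi (f v)) = phi (moment u f).
Proof.
elim: u f => //= j u IH f; rewrite -IH; congr moment.
by apply/funext => w; rewrite gauss_linear.
Qed.

End Morphism.

Section Relations.
Variable V : lmodType K.
Implicit Types (f g : word d -> V) (i j a : 'I_d) (u v w : word d).

Lemma lannZ j c f w : lann j (fun v => c *: f v) w = c *: lann j f w.
Proof. exact: (lann_linear ( *:%R c)). Qed.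

Lemma rannZ j c f w : rann j (fun v => c *: f v) w = c *: rann j f w.
Proof. exact: (rann_linear ( *:%R c)). Qed.

Lemma lannMn j f n w : lann j (fun v => f v *+ n) w = lann j f w *+ n.
Proof.
transitivity (lann j (fun v => n%:R *: f v) w); last by rewrite lannZ scaler_nat.
by apply: eq_lann => v _; rewrite scaler_nat.
Qed.

Lemma rannMn j f n w : rann j (fun v => f v *+ n) w = rann j f w *+ n.
Proof.
transitivity (rann j (fun v => n%:R *: f v) w); last by rewrite rannZ scaler_nat.
by apply: eq_rann => v _; rewrite scaler_nat.
Qed.

(* [lann j f w] only involves words of length [size w - 1]. *)
Lemma lann_size j f w :
  q *: lann j (fun v => q ^+ size v *: f v) w = q ^+ size w *: lann j f w.
Proof.
case: w => [|a w]; first by rewrite /= !scaler0.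
rewrite (eq_lann _ (g := fun v => q ^+ size w *: f v)); last by move=> v [->].
by rewrite lannZ scalerA exprS.
Qed.

Lemma rann_size j f w :
  q *: rann j (fun v => q ^+ size v *: f v) w = q ^+ size w *: rann j f w.
Proof.
case: w => [|a w]; first by rewrite /= !scaler0.
rewrite (eq_rann _ (g := fun v => q ^+ size w *: f v)); last by move=> v [->].
by rewrite rannZ scalerA exprS.
Qed.

(** When the letter taken by [rann] stands left of the one taken by [lann], whichever removal comes
    second passes one letter fewer; so both orders give the same power of [q]. *)
Lemma lann_rann j i f w : lann j (rann i f) w = rann i (lann j f) w.
Proof.
elim: w f => //= a w IH f.
rewrite lannD IH lannMn rannD rannZ rannMn scalerDr -scalerMnr lann_size.
by rewrite [RHS]addrCA addrCA.
Qed.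

Lemma lann_rcons j f w i :
  lann j f (rcons w i) = lann j (fun v => f (rcons v i)) w + q ^+ size w *: f w *+ (i == j).
Proof.
elim: w f => [|a w IH] f /=; first by rewrite scaler0 addr0 add0r expr0 scale1r.
by rewrite IH scalerDr addrA -scalerMnr scalerA exprS.
Qed.

(** The mixed terms agree: a left annihilation reaching the letter appended on the right and a right
    annihilation reaching the letter put in front both cost [q ^+ size w]. *)
Lemma gauss_rgauss j i f w : gauss j (rgauss i f) w = rgauss i (gauss j f) w.
Proof.
rewrite /gauss /rgauss /= lannD rannD lann_rann lann_rcons [j == i]eq_sym.
by rewrite -!addrA; congr (_ + _); rewrite [RHS]addrCA; congr (_ + _); rewrite addrCA.
Qed.

(** On the vacuum the left and right actions of [A_i] agree, and the right one commutes past
    [A^u]. *)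
Lemma moment_rcons u i f : moment (rcons u i) f = moment u (rgauss i f).
Proof.
elim: u f => [|j u IH] f /=; first by rewrite /gauss /rgauss /=.
by rewrite IH; congr moment; apply/funext => w; rewrite gauss_rgauss.
Qed.

Lemma momentD u f g : moment u (fun v => f v + g v) = moment u f + moment u g.
Proof.
elim: u f g => //= j u IH f g; rewrite -IH; congr moment.
by apply/funext => w; rewrite /gauss lannD addrACA.
Qed.

Lemma momentZ u c f : moment u (fun v => c *: f v) = c *: moment u f.
Proof. exact: (moment_linear ( *:%R c)). Qed.

(** The vectors [A^u e_0] with [|u| <= n] span all [e_v] with [|v| <= n], by triangularity:
    [f (j :: v)] is [gauss j f v] minus values of [f] at shorter words. *)
Lemma moment_inj n f g :
  (forall u, (size u <= n)%N -> moment u f = moment u g) ->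
  forall v, (size v <= n)%N -> f v = g v.
Proof.
elim/ltn_ind: n f g => n IH f g e [|j v] /= hv; first exact: (e [::]).
have /= H : gauss j f v = gauss j g v.
  apply: (IH (size v) hv) => // u hu.
  by apply: (e (j :: u)); apply: leq_ltn_trans hu hv.
apply: (@addIr _ (lann j f v)); rewrite -/(gauss j f v) H /gauss; congr (_ + _).
apply: eq_lann => x hx; apply/esym; apply: (IH (size x)); rewrite ?(leq_trans _ hv) ?ltnS -?hx //.
  by move=> u hu; apply: e; rewrite (leq_trans hu) // (leq_trans _ hv) // -hx ltnW.
Qed.

Lemma split_sumMn i (h : word d -> word d -> V) n w :
  split_sum i (fun u v => h u v *+ n) w = split_sum i h w *+ n.
Proof.
elim: w h => /= [|b w IH] h; first by rewrite mul0rn.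
by rewrite mulrnDl IH -!mulrnA mulnC.
Qed.

Lemma lann_split j i (h : word d -> word d -> V) w :
  lann j (split_sum i h) w =
  split_sum i (fun u v => lann j (fun x => h x v) u
                          + q ^+ (size u).+1 *: lann j (h u) v) w.
Proof.
elim: w h => //= a w IH h.
rewrite lannD IH lannMn scalerDr add0r expr1 scalerMnr.
rewrite addrCA; congr (_ + _).
rewrite -split_sumMn -(split_sum_linear ( *:%R q)) -split_sumD; apply: eq_split_sum => u v _ /=.
by rewrite scalerDr scalerA -exprS addrA.
Qed.

End Relations.

(** * The dual operators and the conjugate relation *)

Section DualSystem.
Variable V : lmodType K.
Implicit Types (f g : word d -> V) (i j a : 'I_d) (u v w : word d).

(* Up to the sign and power of [q] absorbed from the recursion, [match_out v f u]
   is [f] at the vector obtained from [e_u] by the right annihilations of the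
   letters of [v], the last letter first. *)
Fixpoint match_out v f u : V :=
  if v is a :: v' then - q ^+ size v *: match_out v' (rann a f) u else f u.

(* The transpose of the dual operator [D_i], which satisfies
   [D_i A_j = A_j D_i + delta_ij P], [P] being the projection onto the vacuum. *)
Definition dual i f w : V := split_sum i (fun u v => match_out v f u) w.

Lemma match_outD v f g u :
  match_out v (fun x => f x + g x) u = match_out v f u + match_out v g u.
Proof.
elim: v f g => //= a v IH f g.
rewrite -scalerDr -IH; congr (_ *: match_out _ _ _).
by apply/funext => x; rewrite rannD.
Qed.

Lemma match_outZ v c f u : match_out v (fun x => c *: f x) u = c *: match_out v f u.
Proof.
elim: v f => //= a v IH f.
rewrite scalerA mulrC -scalerA -IH; congr (_ *: match_out _ _ _).
by apply/funext => x; rewrite rannZ.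
Qed.

Lemma match_outMn v f n u : match_out v (fun x => f x *+ n) u = match_out v f u *+ n.
Proof.
rewrite -scaler_nat -match_outZ; congr match_out.
by apply/funext => x; rewrite scaler_nat.
Qed.

Lemma match_out_lann v j f u : match_out v (lann j f) u = lann j (match_out v f) u.
Proof.
elim: v f => //= a v IH f; rewrite lannZ -IH; congr (_ *: match_out _ _ _).
by apply/funext => x; rewrite lann_rann.
Qed.

Lemma match_out_size v f u :
  q ^+ size v *: match_out v (fun x => q ^+ size x *: f x) u
  = q ^+ size u *: match_out v f u.
Proof.
elim: v f => /= [|a v IH] f; first by rewrite expr0 scale1r.
set m := match_out v _ u.
have e : q ^+ size v *: (q *: m) = q ^+ size u *: match_out v (rann a f) u.
  rewrite -IH -match_outZ; congr (_ *: match_out _ _ _).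
  by apply/funext => x; rewrite rann_size.
rewrite [RHS]scalerA [in RHS]mulrC -[RHS]scalerA -e !scalerA; congr (_ *: _).
by rewrite -mulrA -exprSr mulrC.
Qed.

(** Each right annihilation either passes the front letter [j] or absorbs it. The absorbing terms
    add up to a left annihilation of [j] in [v], and the weights built into [match_out] turn their
    various powers of [q] into the single [q ^+ (size u).+1]. *)
Lemma match_out_cons v f j u :
  match_out v f (j :: u) =
  match_out v (fun x => f (j :: x)) u
  - q ^+ (size u).+1 *: lann j (fun v' => match_out v' f u) v.
Proof.
elim: v f => [|a v IH] f /=; first by rewrite scaler0 subr0.
have e1 : q ^+ (size v).+1 *: match_out v (fun x => q ^+ size x *: f x) u
          = q ^+ (size u).+1 *: match_out v f u.
  by rewrite !exprS -!scalerA match_out_size.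
have e2 : q *: lann j (fun v' => match_out (a :: v') f u) v
          = - q ^+ (size v).+1 *: lann j (fun v' => match_out v' (rann a f) u) v.
  rewrite /= (eq_lann _ (g := fun v' => - q *: (q ^+ size v' *: match_out v' (rann a f) u))).
    by rewrite lannZ scalerA mulrC -scalerA lann_size scalerA exprS mulNr.
  by move=> v' _; rewrite scalerA mulNr -exprS.
rewrite IH /= match_outD match_outMn [j == a]eq_sym.
move: e2; rewrite /= => ->.
rewrite !scaleNr !scalerDr !scalerN -!scalerMnr e1 !scalerA.
by rewrite [q ^+ _ * q ^+ _]mulrC !opprD !opprK -addrA [RHS]addrCA.
Qed.

Definition vacuum_coef w : K^o := (w == [::])%:R.

(** The correction in [match_out_cons] cancels the term of [lann_split] in which the letter is
    removed from the right part [v]. *)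
Lemma gauss_dual j i f w :
  gauss j (dual i f) w = dual i (gauss j f) w + vacuum_coef w *: f [::] *+ (i == j).
Proof.
rewrite /gauss /dual /= lann_split.
(* The cut at the created letter leaves an empty left part, which every right annihilation kills;
   this produces the projection onto the vacuum. *)
have -> : match_out w f [::] = vacuum_coef w *: f [::].
  elim: w f => [|a w IH] f; rewrite /vacuum_coef /= ?scale1r // IH /=.
  by rewrite !scaler0 scale0r.
rewrite -addrA -split_sumD addrC [i == j]eq_sym; congr (_ + _).
apply: eq_split_sum => u v _ /=.
by rewrite match_out_cons match_outD match_out_lann addrACA addNr addr0.
Qed.

End DualSystem.

Lemma momentMn (V : lmodType K) u (f : word d -> V) n :
  moment u (fun v => f v *+ n) = moment u f *+ n.
Proof.
rewrite -scaler_nat -momentZ; congr moment.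
by apply/funext => x; rewrite scaler_nat.
Qed.

(** Moving [D_i] to the right through [A^w] leaves a vacuum projection at each occurrence of [i],
    and [D_i e_0 = 0]. For [f = vacuum_coef] this is the defining relation of the conjugate
    variable. *)
Lemma moment_dual (w : word d) i (f : word d -> K^o) :
  moment w (dual i f) = split_sum i (fun u v => moment u f * moment v vacuum_coef) w.
Proof.
elim: w f => [|j w IH] f //=.
have -> : gauss j (dual i f) =
  fun x => dual i (gauss j f) x + (f [::] *: vacuum_coef x) *+ (j == i).
  apply/funext => x; rewrite gauss_dual [i == j]eq_sym; congr (_ + _ *+ _).
  exact: mulrC.
by rewrite momentD momentMn momentZ IH addrC.
Qed.

Lemma lann_vacuum j w : lann j vacuum_coef w = (w == [:: j])%:R.
Proof.
have lann0 x : lann j (fun _ => 0 : K^o) x = 0.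
  by elim: x => //= b x ->; rewrite mul0rn scaler0 addr0.
case: w => // a w; rewrite eqseq_cons andbC /= lann0 scaler0 addr0 /vacuum_coef.
by case: (w == _); rewrite //= mul0rn.
Qed.

Lemma rann_vacuum j w : rann j vacuum_coef w = (w == [:: j])%:R.
Proof.
have rann0 x : rann j (fun _ => 0 : K^o) x = 0.
  by elim: x => //= b x ->; rewrite scaler0 mul0rn addr0.
case: w => // a w; rewrite eqseq_cons andbC /= rann0 addr0 /vacuum_coef.
by case: w => [|b w] /=; rewrite ?expr0 ?scale1r // scaler0 mul0rn.
Qed.

(** Traciality of the vacuum state: the left and right actions of [A_j] agree on the vacuum and also
    against the vacuum functional. *)
Lemma moment_cycle (u : word d) j :
  moment (rcons u j) vacuum_coef = moment (j :: u) vacuum_coef.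
Proof.
rewrite moment_rcons /=; congr moment; apply/funext => w.
rewrite /gauss /rgauss lann_vacuum rann_vacuum /vacuum_coef.
by case: w => [|a w] //=; rewrite add0r.
Qed.

Lemma lann_lann (V : lmodType K) i j (F : word d -> word d -> V) w v :
  lann j (fun y => lann i (F^~ y) w) v = lann i (fun x => lann j (F x) v) w.
Proof.
elim: v F => /= [|b v IH] F; first by elim: w => //= a w <-; rewrite mul0rn scaler0 addr0.
by rewrite IH lannD lannMn lannZ.
Qed.

(** The q-inner product of [e_w] and [e_v]: the creations that build [e_w] from the vacuum are moved
    across as annihilations of [e_v]. *)
Fixpoint gram (w : word d) : word d -> K^o :=
  if w is i :: w' then lann i (gram w') else vacuum_coef.

Lemma gram_cons w i v : gram w (i :: v) = lann i (fun x => gram x v) w.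
Proof.
elim: w v => [|j w IH] v //=.
rewrite [i == j]eq_sym; congr (_ + _ *: _).
by rewrite -lann_lann; apply: eq_lann => x _; rewrite IH.
Qed.

Lemma gramC w v : gram w v = gram v w.
Proof.
elim: w v => [|i w IH] v /=; last first.
  by rewrite gram_cons; apply: eq_lann => x _; rewrite IH.
by case: v => //= a v; rewrite ?lann_vacuum.
Qed.

Lemma gram_rcons w i v : gram (rcons w i) v = rann i (gram w) v.
Proof.
elim: w v => [|j w IH] v /=; first by rewrite lann_vacuum rann_vacuum.
by rewrite -lann_rann; apply: eq_lann => x _; rewrite IH.
Qed.

End FockOperators.

(** * Wick polynomials *)

Section WickPolynomials.
Variables (K : comNzRingType) (d : nat) (q : K).
Implicit Types (i j k : 'I_d) (u v w : word d).
Local Notation lann := (lann q).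
Local Notation moment := (moment q).
Local Notation gauss := (gauss q).
Local Notation rgauss := (rgauss q).

(** Encodes [W_(jv) = x_j W_v - W_(l_j v)]. The words of [l_j v] are shorter than [v] without being
    subterms of it, hence the fuel [n], immaterial once it reaches [size v]. *)
Fixpoint wick_rec n w v : K^o :=
  match v, n with
  | [::], _ => (w == [::])%:R
  | _, 0 => 0
  | j :: v', n'.+1 =>
      (if w is k :: w' then wick_rec n' w' v' *+ (k == j) else 0)
      - lann j (wick_rec n' w) v'
  end.

(* The coefficient of [x^w] in the Wick polynomial of [e_v], that is, in the
   polynomial mapping the vacuum to [e_v]. *)
Definition wick w v := wick_rec (size v) w v.

Lemma wick_recE n w v : (size v <= n)%N -> wick_rec n w v = wick w v.
Proof.
elim/ltn_ind: n w v => -[|n] IH w [|j v] //= hv.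
rewrite /wick /=; congr (_ - _).
  by case: w => // k w; rewrite IH.
apply: eq_lann => x hx; rewrite IH ?IH //; rewrite -hx ltnS in hv; by rewrite ltnW // -hx.
Qed.

Lemma gauss_wick j w v :
  gauss j (wick w) v = if w is k :: w' then wick w' v *+ (k == j) else 0.
Proof.
rewrite /gauss [wick w (j :: v)]/wick /= -/(wick _ _).
rewrite (eq_lann _ _ (g := wick w)); last by move=> x hx; rewrite wick_recE // -hx.
by case: w => [|k w]; rewrite subrK.
Qed.

Lemma moment0 (V : lmodType K) u : moment u (fun _ => 0 : V) = 0.
Proof.
rewrite -[RHS](scale0r (moment u (fun _ => 0 : V))) -momentZ; congr moment.
by apply/funext => x; rewrite scale0r.
Qed.

(** The polynomial that sends the vacuum to [A^u e_0] is [x^u] itself. *)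
Lemma moment_wick u w : moment u (wick w) = (u == w)%:R.
Proof.
elim: u w => [|j u IH] w /=; first by rewrite /wick /= eq_sym.
have -> : gauss j (wick w) = fun v => if w is k :: w' then wick w' v *+ (k == j) else 0.
  by apply/funext => v; rewrite gauss_wick.
case: w => [|k w]; first by rewrite moment0.
by rewrite momentMn IH eqseq_cons andbC eq_sym [k == j]eq_sym; case: (w == u); rewrite //= mul0rn.
Qed.

(** The Wick recursion works on the left only; its mirror image follows by comparing moments. *)
Lemma rgauss_wick j w k v : rgauss j (wick (rcons w k)) v = wick w v *+ (k == j).
Proof.
apply: (moment_inj (q := q) (n := size v) (f := rgauss j (wick (rcons w k)))
  (g := fun v => wick w v *+ (k == j))) => // u _.
rewrite -moment_rcons momentMn !moment_wick eqseq_rcons [j == k]eq_sym.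
by case: (u == w); rewrite //= mul0rn.
Qed.

End WickPolynomials.

(** * Sums over words graded by length *)

Section LengthSums.
Variable d : nat.

Definition lsum (V : nmodType) n (f : word d -> V) : V := \sum_(u : n.-tuple 'I_d) f u.
Definition wsum (V : nmodType) N (f : word d -> V) : V := \sum_(n < N) lsum n f.

Lemma eq_lsum (V : nmodType) n (f g : word d -> V) :
  (forall u, size u = n -> f u = g u) -> lsum n f = lsum n g.
Proof. by move=> e; apply: eq_bigr => u _; rewrite e ?size_tuple. Qed.

Lemma eq_wsum (V : nmodType) N (f g : word d -> V) : f =1 g -> wsum N f = wsum N g.
Proof. by move=> e; apply: eq_bigr => n _; apply: eq_lsum. Qed.

Lemma lsum0 (V : nmodType) (f : word d -> V) : lsum 0 f = f [::].
Proof.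
rewrite /lsum (bigD1 [tuple]) //= big1 ?addr0 // => u.
by move=> u0; case/eqP: u0; apply/val_inj; rewrite /= [u]tuple0.
Qed.

Lemma lsumS (V : nmodType) n (f : word d -> V) :
  lsum n.+1 f = \sum_(j < d) lsum n (fun u => f (j :: u)).
Proof.
rewrite /lsum pair_big /=.
rewrite (reindex (fun p : 'I_d * n.-tuple 'I_d => [tuple of p.1 :: p.2])) //=.
exists (fun t => (thead t, [tuple of behead t])) => [[j u] _|t _] /=.
  by rewrite theadE; congr (_, _); apply: val_inj.
by rewrite [t in RHS]tuple_eta; apply: val_inj.
Qed.

Lemma lsum_rot (V : nmodType) n k (f : word d -> V) :
  lsum n (fun u => f (rot k u)) = lsum n f.
Proof.
rewrite [RHS]/lsum (reindex_inj (h := fun t : n.-tuple 'I_d => [tuple of rot k t])) //=.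
by move=> t t' /(congr1 val) /rot_inj /val_inj.
Qed.

Lemma wsumS (V : nmodType) N (f : word d -> V) :
  wsum N.+1 f = f [::] + \sum_(j < d) wsum N (fun u => f (j :: u)).
Proof.
rewrite /wsum big_ord_recl lsum0; congr (_ + _).
by rewrite exchange_big; apply: eq_bigr => n _; rewrite lsumS.
Qed.

Lemma wsumSr (V : nmodType) N (f : word d -> V) : wsum N.+1 f = wsum N f + lsum N f.
Proof. by rewrite /wsum big_ord_recr. Qed.

Lemma wsumD (V : nmodType) N (f g : word d -> V) :
  wsum N (fun u => f u + g u) = wsum N f + wsum N g.
Proof. by rewrite -big_split; apply: eq_bigr => n _; rewrite -big_split. Qed.

Lemma wsum_delta (V : nmodType) N (f : word d -> V) u :
  (size u < N)%N -> wsum N (fun w => f w *+ (u == w)) = f u.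
Proof.
elim: N u f => // N IH [|j u] f hu; rewrite wsumS /=.
  rewrite big1 ?addr0 // => j _.
  by rewrite /wsum big1 // => n _; rewrite /lsum big1 // => w _; rewrite mulr0n.
rewrite mulr0n add0r (bigD1 j) //= [X in _ + X]big1 ?addr0.
  rewrite -[RHS](IH u (fun u => f (j :: u))) //; apply: eq_wsum => w.
  by rewrite eqseq_cons eqxx.
move=> k kj; rewrite /wsum big1 // => n _; rewrite /lsum big1 // => w _.
by rewrite eqseq_cons eq_sym (negbTE kj) mulr0n.
Qed.

End LengthSums.

Section WickExpansion.
Variables (K : comNzRingType) (d : nat) (q : K).

Lemma moment_sum (V : lmodType K) I (r : seq I) (F : I -> word d -> V) u :
  moment q u (fun v => \sum_(i <- r) F i v) = \sum_(i <- r) moment q u (F i).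
Proof.
elim: r => [|i r IH].
  rewrite big_nil -[RHS](moment0 q V u); congr (moment q u _).
  by apply/funext => v; rewrite big_nil.
rewrite big_cons -IH -momentD; congr (moment q u _); apply/funext => v.
by rewrite big_cons.
Qed.

Lemma moment_wsum (V : lmodType K) N (F : word d -> word d -> V) u :
  moment q u (fun v => wsum N (fun w => F w v)) = wsum N (fun w => moment q u (F w)).
Proof.
rewrite moment_sum; apply: eq_bigr => n _; exact: moment_sum.
Qed.

(** The Wick polynomial of [e_v] reproduces [e_v]. Both sides have the same moments up to length
    [N - 1], so [moment_inj] applies. *)
Lemma wick_expansion N (h : word d -> K^o) v :
  (size v < N)%N -> wsum N (fun u => wick q u v * moment q u h) = h v.
Proof.
case: N => // N; rewrite ltnS.
apply: (moment_inj (q := q) (f := fun v => wsum N.+1 (fun u => wick q u v * moment q u h))).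
move=> u hu; rewrite moment_wsum -[RHS](@wsum_delta _ _ N.+1 (fun w => moment q w h)) //.
apply: eq_wsum => w; rewrite -mulr_natr -(moment_wick q).
transitivity (moment q w h *: moment q u (wick q w)) => //.
by rewrite -momentZ; congr (moment q u _); apply/funext => x; apply: mulrC.
Qed.

End WickExpansion.

(** * Inverting the q-symmetrizer *)

Section GeometricSeries.
Variable R : realType.
Implicit Types (B : R).

Lemma sum_geometric_le (x : R) n : 0 <= x < 1 -> \sum_(k < n) x ^+ k <= (1 - x)^-1.
Proof.
move=> /andP[x0 x1]; have y0 : 0 < 1 - x by rewrite subr_gt0.
rewrite -(ler_pM2r y0) mulVf ?gt_eqF // mulrC.
rewrite -[1 - x]opprB mulNr -subrX1 opprB lerBlDr lerDl.
exact: exprn_ge0.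
Qed.

Lemma geometric_limit (u : nat -> R) B (x : R) : 0 <= x < 1 ->
  (forall n, `|u n| <= B * x ^+ n) ->
  exists l, forall N, `|l - \sum_(n < N) u n| <= B * x ^+ N / (1 - x).
Proof.
move=> x01 ub; have /andP[x0 x1] := x01.
have B0 : 0 <= B by have := ub 0; rewrite expr0 mulr1; apply: le_trans.
have tail N M : `|\sum_(n < N + M) u n - \sum_(n < N) u n| <= B * x ^+ N / (1 - x).
  rewrite big_split_ord /= addrAC subrr add0r; apply: le_trans (ler_norm_sum _ _ _) _.
  apply: (@le_trans _ _ (\sum_(n < M) B * x ^+ N * x ^+ n)).
    by apply: ler_sum => n _; apply: le_trans (ub _) _; rewrite exprD mulrA.
  by rewrite -mulr_sumr ler_wpM2l ?mulr_ge0 ?exprn_ge0 // sum_geometric_le.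
have cu : cvgn (series u).
  apply: normed_cvg; apply: (series_le_cvg (v_ := geometric B x)).
  - by move=> n /=.
  - by move=> n; rewrite /geometric /= mulr_ge0 ?exprn_ge0.
  - by move=> n; apply: ub.
  - by apply: is_cvg_geometric_series; rewrite ger0_norm.
exists (limn (series u)) => N.
apply/ler_addgt0Pr => eps eps0.
have /cvgrPdist_le /(_ eps eps0) [M _ HM] := cu.
rewrite -(subrKA (\sum_(n < N + M) u n)); apply: le_trans (ler_normD _ _) _.
rewrite addrC; apply: lerD; first exact: tail.
by have := HM (N + M)%N (leq_addl _ _); rewrite /series /= big_mkord.
Qed.

Lemma geometric_small (y : R) B (x : R) : 0 <= x < 1 -> (forall N, `|y| <= B * x ^+ N) -> y = 0.
Proof.
move=> /andP[x0 x1] yB; apply/eqP; rewrite -normr_le0.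
apply/ler_addgt0Pr => eps eps0.
have cx : (geometric B x @ \oo --> (0 : R)) by apply: cvg_geometric; rewrite ger0_norm.
have /cvgrPdist_le /(_ eps eps0) [M _ HM] := cx.
rewrite add0r; apply: le_trans (yB M) _.
by have := HM M (leqnn _); rewrite sub0r normrN; apply: le_trans; apply: ler_norm.
Qed.

(** The solution is the series of the [c ^+ n * g (iter n s x)]. The [s]-stable predicate [P] will
    select the words of one length, where alone [g] is bounded by [B]. *)
Lemma neumann (T : Type) (P : T -> Prop) (s : T -> T) (g : T -> R) B (c : R) :
  `|c| < 1 -> (forall x, P x -> P (s x)) -> (forall x, P x -> `|g x| <= B) ->
  exists h : T -> R, (forall x, P x -> h x - c * h (s x) = g x) /\
    (forall x, P x -> `|h x| <= B / (1 - `|c|)).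
Proof.
move=> c1 Ps gB.
have c01 : 0 <= `|c| < 1 by rewrite normr_ge0.
have Pi n x : P x -> P (iter n s x) by move=> Px; elim: n => //= n; apply: Ps.
have H x : exists l, P x -> forall N,
    `|l - \sum_(n < N) c ^+ n * g (iter n s x)| <= B * `|c| ^+ N / (1 - `|c|).
  have [Px|nPx] := pselect (P x); last by exists 0.
  have [n|l hl] := @geometric_limit (fun n => c ^+ n * g (iter n s x)) B `|c| c01.
    by rewrite normrM normrX mulrC ler_wpM2r ?exprn_ge0 // gB //; apply: Pi.
  by exists l.
have [h hh] := choice H; exists h; split=> x Px; last first.
  by have := hh x Px 0; rewrite big_ord0 subr0 expr0 mulr1.
apply/eqP; rewrite -subr_eq0; apply/eqP.
apply: (@geometric_small _ (2 * (B / (1 - `|c|))) `|c|) => // N.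
have h1 := hh x Px N.+1; have h2 := hh (s x) (Ps x Px) N.
pose S1 := \sum_(n < N.+1) c ^+ n * g (iter n s x).
pose S2 := \sum_(n < N) c ^+ n * g (iter n s (s x)).
have eS : S1 = g x + c * S2.
  rewrite /S1 big_ord_recl expr0 mul1r; congr (_ + _).
  by rewrite mulr_sumr; apply: eq_bigr => n _; rewrite exprS mulrA /= -iterSr.
have -> : h x - c * h (s x) - g x = (h x - S1) - c * (h (s x) - S2).
  by rewrite eS; ring.
apply: le_trans (ler_normB _ _) _; rewrite normrM.
have := ler_wpM2l (normr_ge0 c) h2; move: h1; rewrite -/S1 -/S2 exprS => h1 h2'.
apply: le_trans (lerD h1 h2') _.
have B0 : 0 <= B by apply: le_trans (gB x Px).
have t0 : 0 <= B * `|c| ^+ N / (1 - `|c|).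
  by rewrite divr_ge0 ?mulr_ge0 ?exprn_ge0 // subr_ge0 ltW.
nra.
Qed.

End GeometricSeries.

Section AnnihilationOfSums.
Variables (K : comNzRingType) (d : nat) (q : K) (V : lmodType K) (i : 'I_d).

Lemma lann_sum I (r : seq I) (F : I -> word d -> V) v :
  lann q i (fun x => \sum_(k <- r) F k x) v = \sum_(k <- r) lann q i (F k) v.
Proof.
elim: r => [|k r IH].
  rewrite big_nil -[RHS](scale0r (lann q i (fun _ => 0 : V) v)) -lannZ.
  by apply: eq_lann => x _; rewrite big_nil scale0r.
by rewrite big_cons -IH -lannD; apply: eq_lann => x _; rewrite big_cons.
Qed.

Lemma lann_lsum n (F : word d -> word d -> V) v :
  lann q i (fun x => lsum n (fun w => F w x)) v = lsum n (fun w => lann q i (F w) v).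
Proof. exact: lann_sum. Qed.

Lemma lann_wsum N (F : word d -> word d -> V) v :
  lann q i (fun x => wsum N (fun w => F w x)) v = wsum N (fun w => lann q i (F w) v).
Proof. by rewrite lann_sum; apply: eq_bigr => n _; apply: lann_lsum. Qed.

Lemma rann_sum I (r : seq I) (F : I -> word d -> V) v :
  rann q i (fun x => \sum_(k <- r) F k x) v = \sum_(k <- r) rann q i (F k) v.
Proof.
elim: r => [|k r IH].
  rewrite big_nil -[RHS](scale0r (rann q i (fun _ => 0 : V) v)) -rannZ.
  by apply: eq_rann => x _; rewrite big_nil scale0r.
by rewrite big_cons -IH -rannD; apply: eq_rann => x _; rewrite big_cons.
Qed.

Lemma rann_lsum n (F : word d -> word d -> V) v :
  rann q i (fun x => lsum n (fun w => F w x)) v = lsum n (fun w => rann q i (F w) v).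
Proof. exact: rann_sum. Qed.

End AnnihilationOfSums.

(** * Moving a letter to the front, and Zagier's factorization *)

Section MoveToFront.
Variable d : nat.
Implicit Types (u v w : word d).

Definition push (a : 'I_d) w : word d := if w is b :: w' then b :: a :: w' else [:: a].

Fixpoint pull k w : word d :=
  match k, w with
  | k'.+1, a :: w' => push a (pull k' w')
  | _, _ => w
  end.

Definition keep_head (s : word d -> word d) w : word d :=
  if w is a :: w' then a :: s w' else [::].

Lemma size_pull k w : size (pull k w) = size w.
Proof. by elim: k w => [|k IH] [|a w] //=; rewrite -[in RHS](IH w); case: (pull k w). Qed.

Lemma pull_cat u a v : pull (size u) (u ++ a :: v) = a :: u ++ v.
Proof. by elim: u => //= b u ->. Qed.

(** Write [w = x b y a z] with [|x| = k] and [|y| = m - k]; both sides equal [b a x y z]. *)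
Lemma pull_pull k m w : (k <= m)%N -> (m.+1 < size w)%N ->
  pull k.+1 (pull m.+1 w) = keep_head (pull m) (pull k w).
Proof.
move=> km hm; have kw : (k < size w)%N by rewrite (leq_ltn_trans km) // ltnW.
set x := take k w; have sx : size x = k by rewrite size_takel // ltnW.
have : (0 < size (drop k w))%N by rewrite size_drop subn_gt0.
case e : (drop k w) => [|b y'] // _.
have sy' : size y' = (size w - k.+1)%N by rewrite subnS -(size_drop k) e.
set y := take (m - k) y'; have sy : size y = (m - k)%N.
  by rewrite size_takel // sy'; lia.
have : (0 < size (drop (m - k) y'))%N.
  by rewrite size_drop subn_gt0 sy'; lia.
case e' : (drop (m - k) y') => [|a z] // _.
have ew : w = x ++ b :: y ++ a :: z by rewrite -e' cat_take_drop -e cat_take_drop.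
have ek : pull k w = b :: x ++ y ++ a :: z by rewrite {1}ew -sx pull_cat.
have em : pull m.+1 w = a :: x ++ b :: y ++ z.
  rewrite {1}ew; have -> : m.+1 = size (x ++ b :: y) by rewrite size_cat /= sx sy addnS subnKC.
  by rewrite -cat_cons catA pull_cat -catA.
rewrite ek em -sx; have /= -> := pull_cat (a :: x) b (y ++ z).
have -> : m = size (x ++ y) by rewrite size_cat sx sy subnKC.
by have := pull_cat (x ++ y) a z; rewrite -!catA => ->.
Qed.

End MoveToFront.

Section Inverse.
Variables (R : realType) (d : nat) (q : R).
Hypothesis q_lt1 : `|q| < 1.

(** For [m + 1 = n] this is the transpose of the factor that takes [P^(n-1)] on the last letters to
    [P^(n)]; smaller [m] are the stages of its inversion. *)
Definition pull_sum m (h : word d -> R) v : R := \sum_(k < m.+1) q ^+ k * h (pull k v).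

(* The group algebra identity behind Zagier's factorization of the
   q-symmetrizer. *)
Lemma pull_sum_pull m (h : word d -> R) v : (m.+1 < size v)%N ->
  pull_sum m.+1 h v - q ^+ m.+1 * pull_sum m.+1 h (pull m.+1 v) =
  pull_sum m (fun w => h w - q ^+ m.+2 * h (keep_head (pull m) w)) v.
Proof.
move=> mv; pose S := \sum_(k < m.+1) q ^+ k * h (keep_head (pull m) (pull k v)).
have e1 : pull_sum m.+1 h v = pull_sum m h v + q ^+ m.+1 * h (pull m.+1 v).
  by rewrite /pull_sum big_ord_recr.
have e2 : pull_sum m.+1 h (pull m.+1 v) = h (pull m.+1 v) + q * S.
  rewrite /pull_sum big_ord_recl expr0 mul1r; congr (_ + _).
  rewrite mulr_sumr; apply: eq_bigr => k _.
  by rewrite exprS -mulrA lift0 pull_pull // -ltnS.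
have -> : pull_sum m (fun w => h w - q ^+ m.+2 * h (keep_head (pull m) w)) v
  = pull_sum m h v - q ^+ m.+2 * S.
  by rewrite /pull_sum mulr_sumr -sumrB; apply: eq_bigr => k _; ring.
by rewrite e1 e2 [q ^+ m.+2]exprSr; ring.
Qed.

(** Each numerator bounds an operator [1 - q^(k+1) T], each denominator the Neumann inverse of some
    [1 - q^(k+2) T'], where [T] and [T'] permute letters. *)
Definition inv_factor m : R := \prod_(k < m) ((1 + `|q| ^+ k.+1) / (1 - `|q| ^+ k.+2)).

(** By [pull_sum_pull] the equation at [m + 1] reduces to the one at [m] with right-hand side
    [phi v - q ^+ m.+1 * phi (pull m.+1 v)], followed by a Neumann inversion. *)
Lemma pull_sum_solve n m (phi : word d -> R) (B : R) : (m < n)%N ->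
  (forall v, size v = n -> `|phi v| <= B) ->
  exists h : word d -> R, (forall v, size v = n -> pull_sum m h v = phi v) /\
    (forall v, size v = n -> `|h v| <= inv_factor m * B).
Proof.
elim: m phi B => [|m IH] phi B mn phiB.
  exists phi; split => v hv; last by rewrite /inv_factor big_ord0 mul1r phiB.
  by rewrite /pull_sum big_ord1 expr0 mul1r /=; case: v hv.
have q0 : 0 <= `|q| by [].
have qX k : 0 <= `|q| ^+ k by rewrite exprn_ge0.
have qX1 k : `|q ^+ k.+1| < 1 by rewrite normrX exprn_ilt1.
have psiB v : size v = n ->
    `|phi v - q ^+ m.+1 * phi (pull m.+1 v)| <= (1 + `|q| ^+ m.+1) * B.
  move=> hv; apply: le_trans (ler_normB _ _) _.
  rewrite mulrDl mul1r; apply: lerD; first exact: phiB.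
  by rewrite normrM normrX ler_wpM2l // phiB // size_pull.
have [h' [h'E h'B]] := IH _ _ (ltnW mn) psiB.
have szk (v : word d) : size v = n -> size (keep_head (pull m) v) = n.
  by case: v => //= a v <-; rewrite size_pull.
have [h [hE hB]] := neumann (P := fun v : word d => size v = n) (qX1 m.+1) szk h'B.
have {}hB v : size v = n -> `|h v| <= inv_factor m.+1 * B.
  move=> /hB; rewrite /inv_factor big_ord_recr /= -/(inv_factor m) normrX.
  by congr (_ <= _); ring.
exists h; split => // v hv.
(* The construction solves the equation only after composition with [1 - q^(m+1) pull]. The defect
   [y] then satisfies [y = q^(m+1) y o pull], and iterating this shows that it vanishes. *)
pose y v := pull_sum m.+1 h v - phi v.
have yE w : size w = n -> y w = q ^+ m.+1 * y (pull m.+1 w).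
  move=> hw; apply/eqP; rewrite -subr_eq0; apply/eqP.
  have := pull_sum_pull h (v := w); rewrite hw => /(_ m mn).
  have -> : pull_sum m (fun w => h w - q ^+ m.+2 * h (keep_head (pull m) w)) w = pull_sum m h' w.
    by apply: eq_bigr => k _; rewrite hE // size_pull.
  by rewrite h'E // /y; lra.
pose Y := (\sum_(k < m.+2) inv_factor m.+1 * B) + B.
have yY N w : size w = n -> `|y w| <= Y * `|q ^+ m.+1| ^+ N.
  elim: N w => [|N IHN] w hw.
    rewrite expr0 mulr1 /y; apply: le_trans (ler_normB _ _) _.
    apply: lerD; last exact: phiB.
    apply: le_trans (ler_norm_sum _ _ _) _; apply: ler_sum => k _.
    rewrite normrM -[leRHS]mul1r; apply: ler_pM => //; last by apply: hB; rewrite size_pull.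
    by rewrite normrX exprn_ile1 // ltW.
  by rewrite yE // normrM [_ ^+ N.+1]exprS mulrCA ler_wpM2l // IHN // size_pull.
apply/eqP; rewrite -subr_eq0; apply/eqP; apply: (@geometric_small _ _ Y `|q ^+ m.+1|).
  by rewrite normr_ge0 qX1.
by move=> N; apply: yY.
Qed.

Lemma lann_pull_sum n (h : word d -> R) v : size v = n.+1 ->
  \sum_(i < d) lann q i (fun w => h (i :: w) : R^o) v = pull_sum n h v.
Proof.
rewrite /pull_sum => <-; elim: v h => [|a v IH] h; first by rewrite /= big_ord0 big1.
rewrite /= big_split /= -scaler_sumr big_ord_recl expr0 mul1r; congr (_ + _).
  rewrite (bigD1 a) //= eqxx big1 ?addr0 // => i ia.
  by rewrite eq_sym (negbTE ia).
rewrite (IH (fun y => h (push a y))) [LHS]mulr_sumr; apply: eq_bigr => k _.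
by rewrite exprS mulrA.
Qed.

(** The [k]-th factor is at most [1 + t x^k <= exp (t x^k)], and these exponents have a finite sum.
    Uniformity in [m] is what makes each tensor degree cost one constant [C]. *)
Lemma inv_factor_bounded : exists2 C, 1 <= C & forall m, inv_factor m <= C.
Proof.
set x : R := `|q|; have x0 : 0 <= x := normr_ge0 q.
have y0 : 0 < 1 - x by rewrite subr_gt0.
pose t := 2 / (1 - x); have t0 : 0 <= t by rewrite divr_ge0 // ltW.
have fac k : (1 + x ^+ k.+1) / (1 - x ^+ k.+2) <= expR (t * x ^+ k).
  have xk0 : 0 <= x ^+ k by rewrite exprn_ge0.
  have xk1 : x ^+ k <= 1 by rewrite exprn_ile1 // ltW.
  apply: le_trans (expR_ge1Dx _).
  have xk2 : x ^+ k.+2 <= x by rewrite exprS ler_piMr // exprn_ile1 // ltW.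
  rewrite ler_pdivrMr; last by lra.
  have -> : t * x ^+ k = 2 * x ^+ k / (1 - x) by rewrite /t; ring.
  have h2 : 2 * x ^+ k <= 2 * x ^+ k / (1 - x) * (1 - x ^+ k.+2).
    rewrite mulrAC ler_pdivlMr // ler_wpM2l //; first lra.
    by lra.
  have : x ^+ k.+1 <= x ^+ k by rewrite exprS ler_piMl // ltW.
  have : x ^+ k.+2 <= x ^+ k by rewrite !exprS mulrA ler_piMl // mulr_ile1 // ltW.
  move: h2; set z := _ / _; nra.
have fac_ge0 k : 0 <= (1 + x ^+ k.+1) / (1 - x ^+ k.+2).
  apply: divr_ge0; first by rewrite addr_ge0 ?exprn_ge0.
  by rewrite subr_ge0 exprn_ile1 // ltW.
exists (expR (t / (1 - x))).
  by apply: le_trans (expR_ge1Dx _); rewrite lerDl divr_ge0 // ltW.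
move=> m; apply: (@le_trans _ _ (expR (t * \sum_(k < m) x ^+ k))); last first.
  by rewrite ler_expR ler_wpM2l // sum_geometric_le // x0 /=.
elim: m => [|m IH]; first by rewrite /inv_factor !big_ord0 mulr0 expR0.
rewrite /inv_factor !big_ord_recr /= -/x mulrDr expRD.
apply: ler_pM => //.
by apply: prodr_ge0 => k _.
Qed.

(** Inverts the q-symmetrizer one degree at a time: first the factor [pull_sum n], then, for each
    first letter, the symmetrizer of the lower degree. *)
Lemma gram_solve : exists2 C, 1 <= C & forall n (phi : word d -> R) (B : R),
  (forall v, size v = n -> `|phi v| <= B) ->
  exists f : word d -> R,
    (forall v, size v = n -> lsum n (fun w => f w * gram q w v : R) = phi v) /\
    (forall v, size v = n -> `|f v| <= C ^+ n * B).
Proof.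
have [C C1 facC] := inv_factor_bounded; exists C => //.
elim => [|n IH] phi B phiB.
  exists phi; split => v hv; last by rewrite expr0 mul1r phiB.
  by rewrite lsum0 /= (size0nil hv) /vacuum_coef eqxx mulr1.
(* For [d = 0] there are no such words, and the hypothesis does not force [B] to be nonnegative. *)
have B0 : 0 <= B \/ (forall v : word d, size v <> n.+1).
  have [[v hv]|nv] := pselect (exists v : word d, size v = n.+1).
    by left; apply: le_trans (phiB v hv).
  by right => v hv; apply: nv; exists v.
have [h [hE hB]] := pull_sum_solve (ltnSn n) phiB.
have H i : exists f : word d -> R,
    (forall v, size v = n -> lsum n (fun w => f w * gram q w v : R) = h (i :: v)) /\
    (forall v, size v = n -> `|f v| <= C ^+ n * (inv_factor n * B)).
  by apply: IH => v hv; apply: hB; rewrite /= hv.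
have [f hf] := choice H.
exists (fun w => if w is i :: w' then f i w' else 0); split => [v hv|[|i v] //= [hv]].
  rewrite lsumS -hE // -lann_pull_sum //; apply: eq_bigr => i _.
  transitivity (lann q i (fun x => lsum n (fun w => f i w * gram q w x) : R^o) v).
    by rewrite lann_lsum; apply: eq_lsum => w _; exact/esym/(lannZ q i (f i w) (gram q w)).
  by apply: eq_lann => x hx; rewrite (hf i).1 //; move: hx; rewrite hv => -[].
apply: le_trans ((hf i).2 v hv) _; rewrite exprSr -mulrA ler_wpM2l ?exprn_ge0 //.
  exact: le_trans ler01 C1.
case: B0 => [B0|nv]; first by rewrite ler_wpM2r.
by case: (nv (i :: v)); rewrite /= hv.
Qed.

End Inverse.

(** * The cyclically invariant coefficients *)

Section LengthSumBounds.
Variables (R : numDomainType) (d : nat).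
Implicit Types (f g : word d -> R).

Lemma ler_lsum n f g : (forall u, size u = n -> f u <= g u) -> lsum n f <= lsum n g.
Proof. by move=> fg; apply: ler_sum => u _; rewrite fg ?size_tuple. Qed.

Lemma ler_wsum N f g : (forall u, f u <= g u) -> wsum N f <= wsum N g.
Proof. by move=> fg; apply: ler_sum => n _; apply: ler_lsum. Qed.

Lemma ler_norm_lsum n f : `|lsum n f| <= lsum n (fun u => `|f u|).
Proof. exact: ler_norm_sum. Qed.

Lemma ler_norm_wsum N f : `|wsum N f| <= wsum N (fun u => `|f u|).
Proof.
apply: le_trans (ler_norm_sum _ _ _) _.
by apply: ler_sum => n _; apply: ler_norm_lsum.
Qed.

Lemma lsum_cst n (c : R) : lsum n (fun _ : word d => c) = d%:R ^+ n * c.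
Proof. by rewrite /lsum sumr_const card_tuple card_ord -natrX mulr_natl. Qed.

Lemma lsumZ n (c : R) f : lsum n (fun u => c * f u) = c * lsum n f.
Proof. by rewrite /lsum mulr_sumr. Qed.

Lemma wsumZ N (c : R) f : wsum N (fun u => c * f u) = c * wsum N f.
Proof. by rewrite /wsum mulr_sumr; apply: eq_bigr => n _; rewrite lsumZ. Qed.

End LengthSumBounds.

(** * Bounds on the dual functional and on the Wick coefficients *)

Section Bounds.
Variables (R : realType) (d : nat) (q : R).
Hypothesis q_lt1 : `|q| < 1.
Implicit Types (f g : word d -> R^o) (i j : 'I_d) (u v w : word d) (B : R).

Let a : R := (1 - `|q|)^-1.

Let x_ge0 : 0 <= `|q| := normr_ge0 q.

Let a_eq : 1 + `|q| * a = a.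
Proof. by rewrite /a; field; rewrite subr_eq0 eq_sym lt_eqF. Qed.

Let a_ge1 : 1 <= a.
Proof. by rewrite invf_ge1 ?subr_gt0 // lerBlDr lerDl. Qed.

Lemma normr_mulb (b : bool) (y : R) : `|y *+ b| = `|y| *+ b.
Proof. by case: b; rewrite ?mulr0n ?normr0. Qed.

Lemma norm_lann_le j f w : `|lann q j f w| <= lann `|q| j (fun v => `|f v| : R^o) w.
Proof.
elim: w f => [|b w IH] f /=; first by rewrite normr0.
apply: le_trans (ler_normD _ _) _; rewrite normr_mulb normrM lerD2l.
exact: ler_wpM2l.
Qed.

Lemma lann_bound j f w B : 0 <= B ->
  (forall v, (size v).+1 = size w -> `|f v| <= B) -> `|lann `|q| j f w| <= a * B.
Proof.
move=> B0; elim: w f => [|b w IH] f fB /=; first by rewrite normr0 mulr_ge0 // (le_trans ler01).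
rewrite -a_eq mulrDl mul1r -mulrA; apply: le_trans (ler_normD _ _) _; apply: lerD.
  by rewrite normr_mulb; case: (b == j); rewrite ?mulr0n ?fB.
rewrite normrM normr_id ler_wpM2l //; apply: IH => v hv; apply: fB; by rewrite /= hv.
Qed.

Lemma rann_bound j f w B : 0 <= B ->
  (forall v, (size v).+1 = size w -> `|f v| <= B) -> `|rann q j f w| <= a * B.
Proof.
move=> B0 fB; suff H : `|rann q j f w| <= (\sum_(k < size w) `|q| ^+ k) * B.
  by apply: le_trans H _; rewrite ler_wpM2r // sum_geometric_le // x_ge0.
elim: w f fB => [|b w IH] f fB /=; first by rewrite normr0 big_ord0 mul0r.
rewrite big_ord_recr /= mulrDl [leRHS]addrC; apply: le_trans (ler_normD _ _) _; apply: lerD.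
  rewrite normr_mulb normrM normrX.
  have : `|q| ^+ size w * `|f w| <= `|q| ^+ size w * B by rewrite ler_wpM2l ?exprn_ge0 // fB.
  by case: (b == j) => //; rewrite mulr0n => _; rewrite mulr_ge0 ?exprn_ge0.
by apply: IH => v hv; apply: fB; rewrite /= hv.
Qed.

Lemma match_out_bound v f u B : 0 <= B ->
  (forall y, (size y + size v)%N = size u -> `|f y| <= B) ->
  `|match_out q v f u| <= `|q| ^+ 'C((size v).+1, 2) * a ^+ size v * B.
Proof.
elim: v f B => [|b v IH] f B B0 fB /=.
  by rewrite bin_small // !expr0 !mul1r fB // addn0.
rewrite normrM normrN normrX binS bin1 addnC exprD -!mulrA ler_wpM2l ?exprn_ge0 //.
rewrite exprSr -(mulrA (a ^+ size v)) [leRHS]mulrA.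
apply: IH => [|y hy]; first by rewrite mulr_ge0 // (le_trans ler01).
by apply: rann_bound => // z hz; apply: fB; rewrite /= addnS -addSn hz.
Qed.

Lemma split_sum_bound i (h : word d -> word d -> R^o) w B : 0 <= B ->
  (forall u v, (size u + size v).+1 = size w -> `|h u v| <= B) ->
  `|split_sum i h w| <= (size w)%:R * B.
Proof.
move=> B0; elim: w h => [|b w IH] h hB /=; first by rewrite normr0 mul0r.
rewrite -[X in X%:R]add1n natrD mulrDl mul1r; apply: le_trans (ler_normD _ _) _; apply: lerD.
  by rewrite normr_mulb; case: (b == i); rewrite ?mulr0n // hB.
by apply: IH => u v huv; apply: hB; rewrite /= addSn huv.
Qed.

(** There are at most [n] cuts [u i v], and those that count have [size v = n./2]; each right
    annihilation costs at most [a]. *)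
Definition dual_bound n : R := n%:R * (`|q| ^+ 'C(n./2.+1, 2) * a ^+ n./2).

Lemma dual_vacuum_bound i w :
  `|dual q i (vacuum_coef R (d:=d)) w| <= dual_bound (size w).
Proof.
apply: split_sum_bound => [|u v huv].
  by rewrite mulr_ge0 ?exprn_ge0 // (le_trans ler01).
have [suv|suv] := eqVneq (size u) (size v).
  have -> : (size w)./2 = size v by rewrite -huv suv addnn /= uphalf_double.
  rewrite -[leRHS]mulr1; apply: match_out_bound => // y _.
  by rewrite /vacuum_coef; case: (_ == _); rewrite /= ?normr1 ?normr0.
have : `|match_out q v (vacuum_coef R (d:=d)) u| <= `|q| ^+ 'C((size v).+1, 2) * a ^+ size v * 0.
  apply: match_out_bound => // y hy.
  rewrite /vacuum_coef; case: eqP => [y0|]; last by rewrite normr0.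
  by move: hy suv; rewrite y0 /= add0n => ->; rewrite eqxx.
rewrite mulr0 => /le_trans; apply.
by rewrite mulr_ge0 ?exprn_ge0 // (le_trans ler01).
Qed.

Lemma expr_quadratic_bound (c : R) : 0 <= c ->
  exists M, forall k, c ^+ k * `|q| ^+ 'C(k.+1, 2) <= M.
Proof.
move=> c0; pose t k := c ^+ k * `|q| ^+ 'C(k.+1, 2).
have t0 k : 0 <= t k by rewrite mulr_ge0 ?exprn_ge0.
have cx : (geometric c `|q| @ \oo --> (0 : R)) by apply: cvg_geometric; rewrite normr_id.
(* From [J] on the ratio [c * |q|^(k+1)] of consecutive terms is at most 1, so the maximum occurs
   among the first terms. *)
have /cvgrPdist_le /(_ 1 ltr01) [J _ HJ] := cx.
have tS k : t k.+1 = t k * (c * `|q| ^+ k.+1).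
  by rewrite /t binS bin1 exprD exprS; ring.
have tJ m : t (J + m)%N <= t J.
  elim: m => [|m IH]; first by rewrite addn0.
  rewrite addnS tS; apply: le_trans IH; rewrite ler_piMr //.
  have := HJ (J + m).+1 (leqW (leq_addr _ _)); rewrite sub0r normrN.
  by apply: le_trans; apply: ler_norm.
exists (\sum_(k < J.+1) t k) => k; rewrite -/(t k).
have H l : (l <= J)%N -> t l <= \sum_(k < J.+1) t k.
  rewrite -ltnS => lJ; rewrite (bigD1 (Ordinal lJ)) //= lerDl.
  exact: sumr_ge0.
have [kJ|/ltnW Jk] := leqP k J; first exact: H.
by rewrite -(subnKC Jk); apply: le_trans (tJ _) _; apply: H.
Qed.

Lemma dual_bound_decay (L : R) : 0 <= L ->
  exists M, forall n, L ^+ n * dual_bound n <= M * 2^-1 ^+ n.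
Proof.
(* One factor 2 pays for [n <= 2 ^ n], the other for the decay [2^-n]; adding 1 makes powers of [L']
   monotone, so that [n] may be replaced by [2 k + 1]. *)
move=> L0; pose L' := 1 + 4 * L * a.
have a0 : 0 <= a by rewrite (le_trans ler01).
have La0 : 0 <= 4 * L * a by rewrite !mulr_ge0.
have L'1 : 1 <= L' by rewrite lerDl.
have L'0 : 0 <= L' := le_trans ler01 L'1.
have [M HM] := expr_quadratic_bound (sqr_ge0 L').
exists (L' * M) => n; rewrite exprVn ler_pdivlMr ?exprn_gt0 //.
have n2 : n%:R <= 2 ^+ n :> R by rewrite -natrX ler_nat ltnW // ltn_expl.
set k := n./2; have nk : (n <= 2 * k + 1)%N by rewrite /k; lia.
have kn : (k <= n)%N by rewrite /k; lia.
have h1 : L ^+ n * dual_bound n * 2 ^+ n <= L' ^+ n * `|q| ^+ 'C(k.+1, 2).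
  apply: (@le_trans _ _ ((4 * L * a) ^+ n * `|q| ^+ 'C(k.+1, 2))); last first.
    by rewrite ler_wpM2r ?exprn_ge0 // lerXn2r ?nnegrE // lerDr.
  rewrite /dual_bound -/k.
  have -> : L ^+ n * (n%:R * (`|q| ^+ 'C(k.+1, 2) * a ^+ k)) * 2 ^+ n
     = (n%:R * a ^+ k) * (L ^+ n * 2 ^+ n * `|q| ^+ 'C(k.+1, 2)) by ring.
  have -> : (4 * L * a) ^+ n * `|q| ^+ 'C(k.+1, 2)
     = (2 ^+ n * a ^+ n) * (L ^+ n * 2 ^+ n * `|q| ^+ 'C(k.+1, 2)).
    by rewrite (_ : 4 = 2 * 2 :> R) ?exprMn; ring.
  apply: ler_wpM2r; first by rewrite !mulr_ge0 ?exprn_ge0.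
  by apply: ler_pM => //; rewrite ?exprn_ge0 // ler_weXn2l.
apply: le_trans h1 _; apply: (@le_trans _ _ (L' ^+ (2 * k + 1) * `|q| ^+ 'C(k.+1, 2))).
  by rewrite ler_wpM2r ?exprn_ge0 // ler_weXn2l.
by rewrite addn1 exprS exprM -mulrA ler_wpM2l.
Qed.

(** In [W_(jv) = x_j W_v - W_(l_j v)] the multiplication costs [r] and the annihilation [a] in the
    norm weighted by [r]. The extra 1 makes the base at least 1, which covers the shorter words of
    [l_j v]. *)
Lemma wick_bound (r : R) N v : 0 <= r ->
  wsum N (fun u => `|wick q u v| * r ^+ size u) <= (r + a + 1) ^+ size v.
Proof.
move=> r0; set K := r + a + 1.
have a0 : 0 <= a by rewrite (le_trans ler01).
have K1 : 1 <= K by rewrite lerDr addr_ge0.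
have K0 : 0 <= K by apply: le_trans K1.
elim/ltn_ind: {v}(size v) {-2}v (erefl (size v)) N => -[|n] IH v hv N.
  rewrite (size0nil hv); case: N => [|N]; first by rewrite /wsum big_ord0.
  rewrite wsumS big1 ?addr0 /wick /= ?normr1 ?mulr1 // => j _.
  by rewrite /wsum big1 // => n _; rewrite /lsum big1 // => u _; rewrite normr0 mul0r.
case: v hv => // j v [hv].
have wE u : wick q u (j :: v) = gauss q j (wick q u) v - lann q j (wick q u) v.
  by rewrite /gauss addrK.
apply: (@le_trans _ _ (wsum N (fun u => `|gauss q j (wick q u) v| * r ^+ size u) +
    wsum N (fun u => `|lann q j (wick q u) v| * r ^+ size u))).
  rewrite -wsumD; apply: ler_wsum => u; rewrite wE -mulrDl ler_wpM2r ?exprn_ge0 //.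
  exact: ler_normB.
have h1 : wsum N (fun u => `|gauss q j (wick q u) v| * r ^+ size u) <= r * K ^+ n.
  case: N => [|N]; first by rewrite /wsum big_ord0 mulr_ge0 ?exprn_ge0.
  rewrite wsumS gauss_wick normr0 mul0r add0r (bigD1 j) //= [X in _ + X]big1 ?addr0.
    have := IH n (ltnSn n) v hv N; rewrite hv => /(ler_wpM2l r0); apply: le_trans.
    rewrite -wsumZ; apply: ler_wsum => u.
    by rewrite gauss_wick eqxx mulr1n exprS mulrCA.
  move=> k kj; rewrite /wsum big1 // => m _; rewrite /lsum big1 // => u _.
  by rewrite gauss_wick (negbTE kj) mulr0n normr0 mul0r.
have h2 : wsum N (fun u => `|lann q j (wick q u) v| * r ^+ size u) <= a * K ^+ n.
  apply: (@le_trans _ _ (lann `|q| j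
      (fun x => wsum N (fun u => `|wick q u x| * r ^+ size u) : R^o) v)).
    rewrite lann_wsum; apply: ler_wsum => u.
    apply: le_trans (ler_wpM2r (exprn_ge0 _ r0) (norm_lann_le j (wick q u) v)) _.
    rewrite [leLHS]mulrC -[leLHS]lannZ; under eq_lann => x _ do rewrite [_ *: _]mulrC.
    exact: lexx.
  apply: le_trans (ler_norm _) _; apply: lann_bound => [|x hx]; first exact: exprn_ge0.
  have xn : size x = n.-1 /\ (0 < n)%N by rewrite -hv -hx.
  rewrite ger0_norm; last first.
    by apply: sumr_ge0 => m _; apply: sumr_ge0 => u _; rewrite mulr_ge0 ?exprn_ge0.
  apply: le_trans (IH (size x) _ x erefl N) _; first by rewrite xn.1; lia.
  by rewrite xn.1 ler_weXn2l //; lia.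
apply: le_trans (lerD h1 h2) _; rewrite -mulrDl [size (j :: v)]/= hv exprS ler_wpM2r ?exprn_ge0 //.
by rewrite lerDl.
Qed.

End Bounds.

(** * Traciality as a commutator identity *)

Section SplitSums.
Variables (K : comNzRingType) (d : nat) (q : K).
Implicit Types (i j : 'I_d) (u v w : word d).

Lemma split_sum_rcons (V : lmodType K) i (h : word d -> word d -> V) u j :
  split_sum i h (rcons u j) =
  split_sum i (fun x y => h x (rcons y j)) u + h u [::] *+ (j == i).
Proof.
elim: u h => [|a u IH] h /=; first by rewrite addrC.
by rewrite IH addrA.
Qed.

(** Both sides are the sum of [T x y] over all [size u + 1] ways to cut [u] as [x ++ y], with a
    different end cut written apart. *)
Lemma sum_split_sum_shift (V : lmodType K) (T : word d -> word d -> V) u :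
  \sum_i split_sum i (fun x y => T (rcons x i) y) u + T [::] u =
  \sum_i split_sum i (fun x y => T x (i :: y)) u + T u [::].
Proof.
elim: u T => [|c u IH] T /=; first by rewrite !big1.
have delta (F : 'I_d -> V) : \sum_i F i *+ (c == i) = F c.
  by rewrite (bigD1 c) //= eqxx big1 ?addr0 // => i ic; rewrite eq_sym (negbTE ic).
rewrite !big_split /= !delta.
rewrite [X in X + _ = _]addrC (IH (fun x y => T (c :: x) y)).
by rewrite [LHS]addrC addrA.
Qed.

Local Notation phi i := (dual q i (vacuum_coef K (d:=d))).

(** On moments, the conjugate relation and [moment_cycle] make both sides sums of [tau x * tau y]
    over cuts of [u], with [d] copies of the trivial cut added. *)
Lemma sum_gauss_rgauss w :
  \sum_i gauss q i (phi i) w = \sum_i rgauss q i (phi i) w.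
Proof.
apply: (moment_inj (q := q) (n := size w) (f := fun w => \sum_i gauss q i (phi i) w)
  (g := fun w => \sum_i rgauss q i (phi i) w)) => // u _.
rewrite !moment_sum.
pose tau := fun v => moment q v (vacuum_coef K (d:=d)).
transitivity (\sum_i split_sum i (fun x y => tau (rcons x i) * tau y : K^o) u
   + \sum_(i < d) tau [::] * tau u).
  rewrite -big_split; apply: eq_bigr => i _ /=.
  transitivity (moment q (i :: u) (phi i)); first by [].
  rewrite moment_dual /= eqxx addrC; congr (_ + _).
  by apply: eq_split_sum => x y _; rewrite /tau moment_cycle.
transitivity (\sum_i split_sum i (fun x y => tau x * tau (i :: y) : K^o) u
   + \sum_(i < d) tau u * tau [::]); last first.
  rewrite -big_split; apply: eq_bigr => i _ /=.
  transitivity (moment q (rcons u i) (phi i)); last by rewrite moment_rcons.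
  rewrite moment_dual split_sum_rcons eqxx; congr (_ + _).
  by apply: eq_split_sum => x y _; rewrite moment_cycle.
have := sum_split_sum_shift (fun x y => tau x * tau y : K^o) u.
rewrite [tau [::] * tau u]mulrC => /addIr ->.
by congr (_ + _); apply: eq_bigr => i _; rewrite mulrC.
Qed.

Lemma gram_size w v : size w != size v -> gram q w v = 0.
Proof.
elim: w v => [|i w IH] v /=; first by case: v.
move=> wv; rewrite -[RHS](scale0r (lann q i (fun _ => 0 : K^o) v)) -lannZ.
apply: eq_lann => x xv; rewrite scale0r IH //.
by apply: contra wv => /eqP ->; rewrite xv.
Qed.

End SplitSums.

(** * Power series coefficients of the conjugate variables *)

Section ConjugateCoefficients.
Variables (R : realType) (d : nat) (q r : R).
Hypotheses (q_lt1 : `|q| < 1) (r_ge1 : 1 <= r).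
Implicit Types (i j k : 'I_d) (u v w : word d).

Let a : R := (1 - `|q|)^-1.
Let K : R := r + a + 1.

Local Notation phi i := (dual q i (vacuum_coef R (d:=d))).

Let a_ge0 : 0 <= a.
Proof. by rewrite invr_ge0 subr_ge0 ltW. Qed.

Let r_ge0 : 0 <= r := le_trans ler01 r_ge1.

Let K_ge1 : 1 <= K.
Proof. by rewrite lerDr addr_ge0. Qed.

Let K_ge0 : 0 <= K := le_trans ler01 K_ge1.

Lemma conjugate_wick_coefs : exists (f : 'I_d -> word d -> R) (M : R),
  [/\ 0 <= M,
      forall i v, lsum (size v) (fun w => f i w * gram q w v : R) = phi i v &
      forall i n, lsum n (fun v => `|f i v| * K ^+ n) <= M * 2^-1 ^+ n].
Proof.
have [C C1 HC] := gram_solve d q_lt1.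
have C0 : 0 <= C := le_trans ler01 C1.
have H (p : 'I_d * nat) : exists f : word d -> R,
    (forall v, size v = p.2 -> lsum p.2 (fun w => f w * gram q w v : R) = phi p.1 v) /\
    (forall v, size v = p.2 -> `|f v| <= C ^+ p.2 * dual_bound q p.2).
  by apply: HC => v <-; apply: dual_vacuum_bound.
have [f hf] := choice H.
have L0 : 0 <= C * d%:R * K by rewrite !mulr_ge0.
have [M HM] := dual_bound_decay q_lt1 L0.
exists (fun i w => f (i, size w) w), M; split.
- by have := HM 0%N; rewrite /dual_bound mul0r mulr0 expr0 mulr1.
- move=> i v; rewrite -(hf (i, size v)).1 //=; apply: eq_lsum => w hw.
  by rewrite hw.
- move=> i n; apply: le_trans (HM n).
  rewrite !exprMn (mulrC (C ^+ n)) -!mulrA -lsum_cst; apply: ler_lsum => u hu.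
  rewrite hu [K ^+ n * _]mulrC mulrA ler_wpM2r ?exprn_ge0 //.
  exact: (hf (i, n)).2.
Qed.

Variables (f : 'I_d -> word d -> R) (M : R).
Hypotheses (M_ge0 : 0 <= M)
  (f_gram : forall i v, lsum (size v) (fun w => f i w * gram q w v : R) = phi i v)
  (f_bound : forall i n, lsum n (fun v => `|f i v| * K ^+ n) <= M * 2^-1 ^+ n).

(** The component of degree [n + 1] of the commutator identity for the [xi_i], tested on [g]: it
    receives creations from degree [n] and annihilations from degree [n + 2]. *)
Lemma conjugate_commutator n (g : word d -> R^o) :
  \sum_i lsum n (fun w => f i w * (g (i :: w) - g (rcons w i)) : R)
  + \sum_i lsum n.+2 (fun w => f i w * (lann q i g w - rann q i g w) : R) = 0.
Proof.
pose B := lsum n.+1 (fun v => `|g v|).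
have gB v : size v = n.+1 -> `|g v| <= B.
  move=> hv; have ht : size v == n.+1 by rewrite hv.
  by rewrite /B /lsum (bigD1 (Tuple ht)) //= lerDl sumr_ge0.
have [C _ HC] := gram_solve d q_lt1.
(* In degree [n + 1] the functional [g] is the inner product with the vector of coordinates [c], so
   creations and annihilations can be exchanged as adjoints and [sum_gauss_rgauss] applies. *)
have [c [cE _]] := HC _ _ _ gB.
have cgE v : size v = n.+1 -> g v = lsum n.+1 (fun w => c w * gram q w v : R).
  by move=> hv; rewrite cE.
have exch m (F : word d -> R) (H : word d -> word d -> R) :
    lsum m (fun w => F w * lsum n.+1 (fun y => c y * H y w))
    = lsum n.+1 (fun y => c y * lsum m (fun w => F w * H y w)).
  rewrite /lsum; under eq_bigr do rewrite mulr_sumr.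
  under [RHS]eq_bigr do rewrite mulr_sumr.
  by rewrite exchange_big; apply: eq_bigr => y _; apply: eq_bigr => w _; rewrite mulrCA.
have lannL m i (F : word d -> R) (H : word d -> word d -> R^o) w :
    lann q i (fun x => lsum m (fun y => F y * H y x) : R^o) w
    = lsum m (fun y => F y * lann q i (H y) w).
  by rewrite lann_lsum; apply: eq_lsum => y _; apply: (lannZ q i (F y) (H y)).
have rannL m i (F : word d -> R) (H : word d -> word d -> R^o) w :
    rann q i (fun x => lsum m (fun y => F y * H y x) : R^o) w
    = lsum m (fun y => F y * rann q i (H y) w).
  by rewrite rann_lsum; apply: eq_lsum => y _; apply: (rannZ q i (F y) (H y)).
have E1 i : lsum n (fun w => f i w * g (i :: w))
    = lsum n.+1 (fun y => c y * lann q i (phi i) y).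
  rewrite (eq_lsum (g := fun w => f i w * lsum n.+1 (fun y => c y * gram q y (i :: w)))).
    rewrite exch; apply: eq_lsum => y hy; congr (_ * _).
    rewrite (eq_lann _ _ (g := fun x => lsum n (fun w => f i w * gram q w x))).
      by rewrite lannL; apply: eq_lsum => w _; rewrite gramC.
    by move=> x; rewrite hy => -[<-]; rewrite f_gram.
  by move=> w hw; rewrite cgE //= hw.
have E2 i : lsum n (fun w => f i w * g (rcons w i))
    = lsum n.+1 (fun y => c y * rann q i (phi i) y).
  rewrite (eq_lsum (g := fun w => f i w * lsum n.+1 (fun y => c y * gram q y (rcons w i)))).
    rewrite exch; apply: eq_lsum => y hy; congr (_ * _).
    rewrite (eq_rann _ _ (g := fun x => lsum n (fun w => f i w * gram q w x))).
      by rewrite rannL; apply: eq_lsum => w _; rewrite gramC gram_rcons.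
    by move=> x; rewrite hy => -[<-]; rewrite f_gram.
  by move=> w hw; rewrite cgE // size_rcons hw.
have E3 i : lsum n.+2 (fun w => f i w * lann q i g w)
    = lsum n.+1 (fun y => c y * phi i (i :: y)).
  rewrite (eq_lsum (g := fun w => f i w * lsum n.+1 (fun y => c y * gram q (i :: y) w))).
    rewrite exch; apply: eq_lsum => y hy; congr (_ * _).
    by rewrite -f_gram /= hy; apply: eq_lsum => w _; rewrite gramC.
  move=> w hw; rewrite -lannL; congr (_ * _); apply: eq_lann => x.
  by rewrite hw => -[/cgE].
have E4 i : lsum n.+2 (fun w => f i w * rann q i g w)
    = lsum n.+1 (fun y => c y * phi i (rcons y i)).
  rewrite (eq_lsum (g := fun w => f i w * lsum n.+1 (fun y => c y * gram q (rcons y i) w))).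
    rewrite exch; apply: eq_lsum => y hy; congr (_ * _).
    by rewrite -f_gram size_rcons hy; apply: eq_lsum => w _; rewrite gramC.
  move=> w hw; rewrite (eq_lsum (g := fun y => c y * rann q i (gram q y) w)) => [|y _].
    by rewrite -rannL; congr (_ * _); apply: eq_rann => x; rewrite hw => -[/cgE].
  by rewrite gram_rcons.
have lB m (F G : word d -> R) : lsum m (fun w => F w - G w) = lsum m F - lsum m G.
  by rewrite /lsum sumrB.
have lD m (F G : word d -> R) : lsum m (fun w => F w + G w) = lsum m F + lsum m G.
  by rewrite /lsum big_split.
rewrite -big_split /=.
transitivity (\sum_(i < d) lsum n.+1 (fun y => c y * (gauss q i (phi i) y - rgauss q i (phi i) y))).
  apply: eq_bigr => i _.
  rewrite (eq_lsum (n := n) (g := fun w => f i w * g (i :: w) - f i w * g (rcons w i))); last first.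
    by move=> w _; rewrite mulrBr.
  rewrite lB E1 E2.
  rewrite (eq_lsum (n := n.+2)
    (g := fun w => f i w * lann q i g w - f i w * rann q i g w)); last first.
    by move=> w _; rewrite mulrBr.
  rewrite lB E3 E4 -!lB -lD; apply: eq_lsum => y _.
  by rewrite /gauss /rgauss; ring.
rewrite exchange_big /= /lsum big1 // => y _.
by rewrite -mulr_sumr sumrB sum_gauss_rgauss subrr mulr0.
Qed.

(** The coefficient of [x^u] in the Wick polynomial of the part of [xi_i] of degree below [N]. *)
Let B_approx N i u : R := wsum N (fun v => f i v * wick q u v).

Let half01 : 0 <= (2^-1 : R) < 1.
Proof. by rewrite invr_ge0 ler0n invf_lt1 ?ltr0n // ltr1n. Qed.

Let half_ge0 n : 0 <= (2^-1 : R) ^+ n.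
Proof. by rewrite exprn_ge0 // invr_ge0. Qed.

Let lsum_ge0 n (F : word d -> R) : (forall u, 0 <= F u) -> 0 <= lsum n F.
Proof. by move=> F0; apply: sumr_ge0. Qed.

Let wsum_ge0 n (F : word d -> R) : (forall u, 0 <= F u) -> 0 <= wsum n F.
Proof. by move=> F0; apply: sumr_ge0 => k _; apply: lsum_ge0. Qed.

Let rX_ge0 n : 0 <= r ^+ n.
Proof. exact: exprn_ge0. Qed.

Lemma wick_le w v : `|wick q w v| <= K ^+ size v.
Proof.
apply: (@le_trans _ _ (`|wick q w v| * r ^+ size w)).
  by rewrite ler_peMr // exprn_ege1.
apply: le_trans (wick_bound q_lt1 (size w).+1 v r_ge0).
rewrite -[leLHS](wsum_delta (N := (size w).+1) (fun w => `|wick q w v| * r ^+ size w)) //.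
apply: ler_wsum => x; case: (w == x); rewrite ?mulr1n // mulr0n.
by rewrite mulr_ge0.
Qed.

Lemma wick_term_bound i u n : `|lsum n (fun v => f i v * wick q u v)| <= M * 2^-1 ^+ n.
Proof.
apply: le_trans (ler_norm_lsum _ _) _; apply: le_trans (f_bound i n).
apply: ler_lsum => v hv; rewrite normrM ler_wpM2l // -hv; exact: wick_le.
Qed.

Lemma conjugate_coef_exists : exists B : 'I_d -> word d -> R,
  forall i u N, `|B i u - B_approx N i u| <= 2 * M * 2^-1 ^+ N.
Proof.
have H (p : 'I_d * word d) : exists l, forall N,
    `|l - B_approx N p.1 p.2| <= 2 * M * 2^-1 ^+ N.
  have [l hl] := geometric_limit half01 (wick_term_bound p.1 p.2).
  exists l => N; apply: le_trans (hl N) _.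
  have -> : 1 - 2^-1 = 2^-1 :> R by field.
  by rewrite invrK mulrC mulrA.
have [B hB] := choice H.
by exists (fun i u => B (i, u)) => i u N; apply: (hB (i, u)).
Qed.

Variable B : 'I_d -> word d -> R.
Hypothesis B_lim : forall i u N, `|B i u - B_approx N i u| <= 2 * M * 2^-1 ^+ N.

(** The pointwise rate [B_lim] cannot be summed over [u] uniformly in [N]; exchanging the sums and
    applying [wick_bound] in each degree of [v] can. *)
Lemma conjugate_coef_tail i n N :
  wsum N (fun u => `|B i u - B_approx n i u| * r ^+ size u) <= 2 * M * 2^-1 ^+ n.
Proof.
(* Truncation at [n + m] comes in between; [c] depends on [N], but its factor [2^-m] vanishes as [m]
   grows. *)
pose c := wsum N (fun u : word d => 2 * M * r ^+ size u).
suff H m : wsum N (fun u => `|B i u - B_approx n i u| * r ^+ size u)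
    <= c * 2^-1 ^+ m + 2 * M * 2^-1 ^+ n.
  rewrite -subr_le0; set y := _ - _.
  have H' m : y <= c * 2^-1 ^+ m by rewrite lerBlDr.
  have := half01; case/andP => h0 h1.
  rewrite leNgt; apply/negP => y0.
  have yE : y = 0.
    apply: (@geometric_small _ y c 2^-1) => // m.
    by rewrite gtr0_norm.
  by move: y0; rewrite yE ltxx.
apply: (@le_trans _ _ (wsum N (fun u => 2 * M * 2^-1 ^+ (n + m) * r ^+ size u)
    + \sum_(k < m) wsum N (fun u =>
        lsum (n + k) (fun v => `|f i v| * `|wick q u v|) * r ^+ size u))).
  pose S u := \sum_(k < m) lsum (n + k) (fun v => `|f i v| * `|wick q u v|).
  rewrite [X in _ <= _ + X](_ : _ = wsum N (fun u => S u * r ^+ size u)); last first.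
    rewrite /wsum exchange_big; apply: eq_bigr => l _.
    rewrite /lsum exchange_big; apply: eq_bigr => u _.
    by rewrite /S mulr_suml.
  rewrite -wsumD; apply: ler_wsum => u; rewrite -mulrDl ler_wpM2r //.
  rewrite -(subrKA (B_approx (n + m) i u)); apply: le_trans (ler_normD _ _) _.
  apply: lerD; first exact: B_lim.
  rewrite /B_approx /wsum big_split_ord /= addrAC subrr add0r.
  apply: le_trans (ler_norm_sum _ _ _) _; apply: ler_sum => k _.
  apply: le_trans (ler_norm_lsum _ _) _; apply: ler_lsum => v _.
  by rewrite normrM.
apply: lerD.
  rewrite [leRHS]mulrC /c -wsumZ; apply: ler_wsum => u; rewrite exprD.
  have -> : 2^-1 ^+ m * (2 * M * r ^+ size u) = (2 * M * 2^-1 ^+ m * r ^+ size u) by ring.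
  rewrite ler_wpM2r // -!mulrA ler_wpM2l // ler_wpM2l // ler_piMl //.
  by have /andP[h0 h1] := half01; rewrite exprn_ile1 // ltW.
apply: (@le_trans _ _ (\sum_(k < m) M * 2^-1 ^+ n * 2^-1 ^+ k)).
  apply: ler_sum => k _; rewrite -mulrA -exprD; apply: le_trans (f_bound i _).
  rewrite [leLHS](_ : _ = lsum (n + k) (fun v => `|f i v| *
      wsum N (fun u => `|wick q u v| * r ^+ size u))).
    apply: ler_lsum => v hv; rewrite ler_wpM2l // -hv; exact: wick_bound.
  rewrite /wsum; under [RHS]eq_lsum do rewrite mulr_sumr.
  rewrite [RHS]exchange_big; apply: eq_bigr => l _.
  rewrite /lsum; under [LHS]eq_bigr do rewrite mulr_suml.
  rewrite exchange_big; apply: eq_bigr => v _; rewrite mulr_sumr.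
  by apply: eq_bigr => u _; rewrite mulrA.
rewrite -mulr_sumr -mulrA mulrCA [leRHS](_ : _ = M * 2^-1 ^+ n * 2); last by ring.
rewrite mulrA [2^-1 ^+ n * M]mulrC ler_wpM2l ?mulr_ge0 //.
apply: le_trans (sum_geometric_le _ half01) _.
by have -> : 1 - 2^-1 = 2^-1 :> R by [field]; rewrite invrK.
Qed.

Lemma conjugate_coef_sum i N : wsum N (fun u => `|B i u| * r ^+ size u) <= 2 * M.
Proof.
have := conjugate_coef_tail i 0 N; rewrite expr0 mulr1; apply: le_trans.
by apply: ler_wsum => u; rewrite /B_approx /wsum big_ord0 subr0.
Qed.

(** With [B_approx N] for [B] the sum is exact, because Wick polynomials of words shorter than [N]
    are recovered by [wick_expansion] and degrees other than [size y] are orthogonal to [e_y]. The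
    tail estimate gives the error. *)
Lemma conjugate_coef_dual i y t N : (size y < N)%N ->
  (forall u, `|moment q u (fun w => gram q w y)| <= t * r ^+ size u) ->
  `|wsum N (fun u => B i u * moment q u (fun w => gram q w y)) - phi i y|
    <= t * (2 * M * 2^-1 ^+ N).
Proof.
move=> yN ht; set T := fun u => moment q u (fun w => gram q w y).
have t0 : 0 <= t by have := ht [::]; rewrite expr0 mulr1; apply: le_trans.
have -> : phi i y = wsum N (fun u => B_approx N i u * T u).
  transitivity (wsum N (fun v => f i v * gram q v y)).
    rewrite -f_gram /wsum (bigD1 (Ordinal yN)) //= [X in _ = _ + X]big1 ?addr0 // => n ny.
    rewrite /lsum big1 // => v _; rewrite gram_size ?mulr0 // size_tuple.
    by apply: contra ny => /eqP e; apply/eqP/val_inj.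
  rewrite /B_approx.
  rewrite [RHS](_ : _ = wsum N (fun v => f i v * wsum N (fun u => wick q u v * T u))).
    apply: eq_bigr => n _; apply: eq_lsum => v hv.
    by rewrite wick_expansion // hv.
  rewrite /wsum.
  transitivity (\sum_(n < N) \sum_(u : n.-tuple 'I_d) \sum_(m < N) \sum_(v : m.-tuple 'I_d)
     f i v * (wick q u v * T u)).
    apply: eq_bigr => n _; apply: eq_bigr => u _; rewrite mulr_suml; apply: eq_bigr => m _.
    by rewrite mulr_suml; apply: eq_bigr => v _; rewrite mulrA.
  transitivity (\sum_(n < N) \sum_(m < N) \sum_(u : n.-tuple 'I_d) \sum_(v : m.-tuple 'I_d)
     f i v * (wick q u v * T u)).
    by apply: eq_bigr => n _; rewrite exchange_big.
  rewrite exchange_big; apply: eq_bigr => m _.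
  under eq_bigr do rewrite exchange_big.
  rewrite exchange_big; apply: eq_bigr => v _ /=.
  rewrite mulr_sumr; apply: eq_bigr => n _; by rewrite mulr_sumr.
rewrite -[X in `|X|](_ : wsum N (fun u => (B i u - B_approx N i u) * T u) = _); last first.
  rewrite /wsum -sumrB; apply: eq_bigr => n _; rewrite /lsum -sumrB.
  by apply: eq_bigr => u _; rewrite mulrBl.
apply: le_trans (ler_norm_wsum _ _) _.
apply: le_trans (ler_wpM2l t0 (conjugate_coef_tail i N N)).
rewrite -wsumZ; apply: ler_wsum => u; rewrite normrM mulrCA.
by apply: ler_wpM2l => //; apply: ht.
Qed.

(** Both numbers are the coefficient of [x^w], [w = i x j]: the left one in the sum of the
    [x_k xi_k], the right one in the sum of the [xi_k x_k]. *)
Lemma conjugate_coef_cycle i j x : B i (rcons x j) = B j (i :: x).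
Proof.
pose w := i :: rcons x j; pose g := wick q w.
pose A n := \sum_k lsum n (fun v => f k v * (g (k :: v) - g (rcons v k)) : R).
(* The annihilation part of degree [n + 2] is [- A n], and those of degrees 0 and 1 vanish since
   left and right annihilation agree there; only the last two creation parts survive. *)
have tele N : B_approx N.+2 i (rcons x j) - B_approx N.+2 j (i :: x) = A N + A N.+1.
  pose Bt n := \sum_k lsum n (fun v => f k v * (lann q k g v - rann q k g v) : R).
  have delta (h : word d -> R) i0 : wsum N.+2 (fun v => f i0 v * h v)
      = \sum_k wsum N.+2 (fun v => f k v * (h v *+ (i0 == k))).
    rewrite (bigD1 i0) //= eqxx [X in _ + X]big1 ?addr0 // => k ki.
    rewrite /wsum big1 // => n _; rewrite /lsum big1 // => v _.
    by rewrite eq_sym (negbTE ki) mulr0n mulr0.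
  have e1 : B_approx N.+2 i (rcons x j) = \sum_k wsum N.+2 (fun v => f k v * gauss q k g v).
    by rewrite /B_approx delta; apply: eq_bigr => k _; apply: eq_wsum => v; rewrite gauss_wick.
  have e2 : B_approx N.+2 j (i :: x) = \sum_k wsum N.+2 (fun v => f k v * rgauss q k g v).
    rewrite /B_approx delta; apply: eq_bigr => k _; apply: eq_wsum => v.
    by rewrite /g /w -rcons_cons rgauss_wick.
  have -> : B_approx N.+2 i (rcons x j) - B_approx N.+2 j (i :: x) = \sum_(n < N.+2) (A n + Bt n).
    rewrite e1 e2 -sumrB; transitivity (\sum_(k < d) \sum_(n < N.+2)
        (lsum n (fun v => f k v * (g (k :: v) - g (rcons v k)) : R)
         + lsum n (fun v => f k v * (lann q k g v - rann q k g v) : R))).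
      apply: eq_bigr => k _; rewrite /wsum -sumrB; apply: eq_bigr => n _.
      rewrite /lsum -sumrB -big_split; apply: eq_bigr => v _ /=.
      by rewrite /gauss /rgauss; ring.
    by rewrite exchange_big; apply: eq_bigr => n _; rewrite big_split.
  elim: N {delta e1 e2} => [|N IH].
    rewrite big_ord_recr big_ord1 /=.
    have -> : Bt 0%N = 0 by rewrite /Bt big1 // => k _; rewrite lsum0 /= subrr mulr0.
    have -> : Bt 1%N = 0.
      rewrite /Bt big1 // => k _; rewrite lsumS big1 // => k' _.
      by rewrite lsum0 /= scaler0 expr0 scale1r subrr mulr0.
    by rewrite !addr0.
  rewrite big_ord_recr /= IH; have := conjugate_commutator N g; rewrite -/(A N) -/(Bt N.+2).
  by move: (A N) (A N.+1) (A N.+2) (Bt N.+2) => a0 a1 a2 b e; lra.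
have AB n : `|A n| <= 2 * d%:R * K * M * 2^-1 ^+ n.
  apply: le_trans (ler_norm_sum _ _ _) _.
  apply: (@le_trans _ _ (\sum_(k < d) 2 * K * (M * 2^-1 ^+ n))); last first.
    rewrite sumr_const card_ord.
    have -> : 2 * d%:R * K * M * 2^-1 ^+ n = d%:R * (2 * K * (M * 2^-1 ^+ n)) by ring.
    by rewrite [leRHS]mulr_natl.
  apply: ler_sum => k _; apply: le_trans (ler_norm_lsum _ _) _.
  apply: (@le_trans _ _ (2 * K * lsum n (fun v => `|f k v| * K ^+ n))).
    rewrite -lsumZ; apply: ler_lsum => v hv.
    rewrite normrM mulrCA ler_wpM2l // -mulrA -exprS mulr2n mulrDl mul1r.
    apply: le_trans (ler_normB _ _) _; apply: lerD; apply: le_trans (wick_le _ _) _.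
      by rewrite /= hv.
    by rewrite size_rcons hv.
  by rewrite ler_wpM2l ?mulr_ge0.
apply/eqP; rewrite -subr_eq0; apply/eqP.
apply: (@geometric_small _ _ (4 * M + 4 * d%:R * K * M) 2^-1) => // N.
have h1 := B_lim i (rcons x j) N.+2; have h2 := B_lim j (i :: x) N.+2.
have -> : B i (rcons x j) - B j (i :: x)
  = (B i (rcons x j) - B_approx N.+2 i (rcons x j)) - (B j (i :: x) - B_approx N.+2 j (i :: x))
    + (A N + A N.+1) by rewrite -tele; ring.
apply: le_trans (ler_normD _ _) _.
apply: le_trans (lerD (ler_normB _ _) (ler_normD _ _)) _.
apply: le_trans (lerD (lerD h1 h2) (lerD (AB N) (AB N.+1))) _.
have h0 := half_ge0 N; rewrite !exprS; move: h0; set h := 2^-1 ^+ N => h0.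
have : 0 <= M * h by rewrite mulr_ge0.
have : 0 <= d%:R * K * M * h by rewrite !mulr_ge0.
by lra.
Qed.

End ConjugateCoefficients.

(** Here [b (i :: u)] is the coefficient of [A^u] in [xi_i]. The growth bound on moments is left as
    a premise: it will come from operator norms, which the algebraic part does not have. *)
Lemma cyclic_conjugate_coefs (R : realType) (d : nat) (q r : R) :
  `|q| < 1 -> 1 <= r ->
  exists (b : word d -> R) (M : R),
  [/\ b [::] = 0, forall u, b (rot 1 u) = b u,
      forall i N, wsum N (fun u => `|b (i :: u)| * r ^+ size u) <= M &
      forall i y t N, (size y < N)%N ->
        (forall u, `|moment q u (fun w => gram q w y)| <= t * r ^+ size u) ->
        `|wsum N (fun u => b (i :: u) * moment q u (fun w => gram q w y))
          - dual q i (vacuum_coef R (d:=d)) y| <= t * (M * 2^-1 ^+ N)].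
Proof.
move=> q1 r1.
have [f [M [M0 fE fB]]] := conjugate_wick_coefs d q1 r1.
have [B HB] := conjugate_coef_exists q1 r1 fB.
exists (fun w => if w is i :: u then B i u else 0), (2 * M); split => //.
- case=> [|i [|j u]] //; rewrite rot1_cons /=.
  exact: (conjugate_coef_cycle q1 r1 M0 fE fB HB).
- by move=> i N; apply: (conjugate_coef_sum q1 r1 M0 fB HB).
- by move=> i y t N; apply: (conjugate_coef_dual q1 r1 M0 fE fB HB).
Qed.

(** * The q-inner product *)

Section GramPermutations.
Variables (R : realType) (d : nat) (q : R).
Implicit Types (i j : 'I_d) (u v w : word d).

Definition fun_word n (t : 'I_n -> 'I_d) : word d := [seq t k | k <- enum 'I_n].

Lemma fun_wordS n (t : 'I_n.+1 -> 'I_d) :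
  fun_word t = t ord0 :: fun_word (fun k => t (lift ord0 k)).
Proof. by rewrite /fun_word enum_ordSl /= -map_comp. Qed.

Lemma fun_word_tnth w : fun_word (tnth (in_tuple w)) = w.
Proof. by rewrite /fun_word map_tnth_enum. Qed.

Lemma lann_fun_word n i (f : word d -> R^o) (t : 'I_n.+1 -> 'I_d) :
  lann q i f (fun_word t) =
  \sum_(k < n.+1) q ^+ k * f (fun_word (fun l => t (lift k l))) *+ (t k == i).
Proof.
elim: n f t => [|n IH] f t.
  by rewrite big_ord1 fun_wordS /fun_word enum_ord0 /= scaler0 addr0 expr0 mul1r.
rewrite fun_wordS /= IH [RHS]big_ord_recl expr0 mul1r; congr (_ + _).
rewrite scaler_sumr; apply: eq_bigr => k _.
rewrite fun_wordS scalerMnr -[q *: _]/(q * _) exprS mulrA mulrnAr.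
congr (_ * f (_ :: _) *+ _); first by congr t; apply: val_inj.
by congr fun_word; apply/funext => l; congr t; apply: val_inj => /=; rewrite !/bump; lia.
Qed.

Lemma inversionsE n (s : 'S_n) :
  inversions s = (\sum_(k < n) \sum_(l < n) ((k < l) && (s l < s k)))%N.
Proof.
rewrite /inversions -sum1_card big_mkcond /= pair_big; apply: eq_bigr => p _.
by rewrite inE /=; case: (_ && _).
Qed.

Lemma inversions_lift n (k : 'I_n.+1) (s : 'S_n) :
  inversions (lift_perm ord0 k s) = (k + inversions s)%N.
Proof.
rewrite !inversionsE big_ord_recl; congr (_ + _)%N.
  rewrite big_ord_recl /= add0n.
  transitivity (\sum_(l < n) (s l < k))%N.
    apply: eq_bigr => l _; rewrite lift_perm_lift lift_perm_id /= /bump; congr nat_of_bool; lia.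
  transitivity (\sum_(l < n) (l < k))%N.
    by rewrite [RHS](reindex_inj (@perm_inj _ s)).
  rewrite (eq_bigr (fun l : 'I_n => if (l < k)%N then 1 else 0)%N); last by move=> l _; case: ifP.
  rewrite -big_mkcond /= (big_ord_narrow (leq_ord k)) sum1_card.
  exact: card_ord.
apply: eq_bigr => x _; rewrite big_ord_recl /= add0n; apply: eq_bigr => l _.
rewrite !lift_perm_lift /= /bump; congr nat_of_bool; lia.
Qed.

Lemma lift_perm_bij n : bijective (fun p : 'I_n.+1 * 'S_n => lift_perm ord0 p.1 p.2).
Proof.
apply: inj_card_bij => [[k s] [k' s'] /= e|].
  have ek : k = k' by rewrite -(lift_perm_id ord0 k s) e lift_perm_id.
  subst k'; congr (_, _); apply/permP => x.
  by apply: (@lift_inj _ k); rewrite -!(lift_perm_lift ord0) e.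
by rewrite card_prod card_ord !card_Sn factS.
Qed.

(** Permutations are sorted by their first value [k]: it accounts for [k] inversions, and [t k] is
    the letter that [lann] removes with weight [q ^+ k]. *)
Lemma perm_sum_gram n (t : 'I_n -> 'I_d) v :
  \sum_(s : 'S_n | v == fun_word (fun k => t (s k))) q ^+ inversions s
  = gram q v (fun_word t).
Proof.
elim: n t v => [|n IH] t [|i v].
- rewrite /fun_word enum_ord0 /= (bigD1 1%g) //= big1 ?addr0 => [|s].
    by rewrite inversionsE big_ord0.
  by move=> /negP; case; apply/eqP/permP => -[].
- by rewrite /fun_word enum_ord0 /= big_pred0.
- rewrite /= /vacuum_coef fun_wordS /= big_pred0 // => s.
  by rewrite fun_wordS.
rewrite /= lann_fun_word (reindex _ (onW_bij _ (lift_perm_bij n))) /=.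
rewrite big_mkcond /= -(pair_bigA _ (fun k s => if i :: v ==
   fun_word (fun l => t (lift_perm ord0 k s l)) then q ^+ inversions (lift_perm ord0 k s) else 0)).
apply: eq_bigr => k _; rewrite -IH mulr_sumr [in RHS]big_mkcond -sumrMnl.
apply: eq_bigr => s _; rewrite fun_wordS lift_perm_id eqseq_cons [i == _]eq_sym.
have -> : (fun l => t (lift_perm ord0 k s (lift ord0 l))) = (fun l => t (lift k (s l))).
  by apply/funext => l; rewrite lift_perm_lift.
rewrite inversions_lift exprD.
by case: (t k == i); rewrite ?mulr1n ?mulr0n //=; case: ifP.
Qed.

Lemma perm_word_gram v w :
  \sum_(s : 'S_(size w) | v == perm_word s) q ^+ inversions s = gram q v w.
Proof. by rewrite -[w in RHS]fun_word_tnth -perm_sum_gram. Qed.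

End GramPermutations.

(** * Operators on the completed Fock space *)

Local Open Scope complex_scope.

Section ComplexOperators.
Variable R : realType.

Definition linear_of (V W : lmodType R[i]) (f : V -> W) (lf : linear f) : {linear V -> W} :=
  HB.pack f (GRing.isLinear.Build R[i] V W *:%R f lf).

Definition renorm (V : normedModType R[i]) (x : V) : R := complex.Re `|x|.

Section RealNorm.
Variable V : normedModType R[i].
Implicit Types x y z : V.

Lemma renormE x : `|x| = (renorm x)%:C.
Proof. by rewrite /renorm RRe_real // ger0_real. Qed.

Lemma renorm_le x (c : R) : (`|x| <= c%:C) = (renorm x <= c).
Proof. by rewrite renormE lecR. Qed.

Lemma renorm_ge0 x : 0 <= renorm x.
Proof. by rewrite -ler0c -renormE. Qed.

Lemma renorm0 : renorm (0 : V) = 0.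
Proof. by rewrite /renorm normr0. Qed.

Lemma renorm_eq0 x : renorm x = 0 -> x = 0.
Proof. by move=> e; apply/eqP; rewrite -normr_eq0 renormE e. Qed.

Lemma renormD x y : renorm (x + y) <= renorm x + renorm y.
Proof. by rewrite -renorm_le rmorphD /= -!renormE ler_normD. Qed.

Lemma renormN x : renorm (- x) = renorm x.
Proof. by rewrite /renorm normrN. Qed.

Lemma renormB x y : renorm (x - y) <= renorm x + renorm y.
Proof. by apply: le_trans (renormD _ _) _; rewrite renormN. Qed.

Lemma renorm_sum I (r : seq I) (P : pred I) (F : I -> V) :
  renorm (\sum_(i <- r | P i) F i) <= \sum_(i <- r | P i) renorm (F i).
Proof.
elim/big_ind2: _ => // [|x a y b xa yb]; first by rewrite renorm0.
by apply: le_trans (renormD _ _) _; apply: lerD.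
Qed.

End RealNorm.

Lemma renormZ (V : normedModType R[i]) (a : R[i]) (x : V) :
  renorm (a *: x) = complex.Re `|a| * renorm x.
Proof.
by apply: complexI; rewrite -renormE normrZ rmorphM /= -renormE.
Qed.

Lemma norm_real_complex (a : R) : `|a%:C| = (`|a|)%:C.
Proof. by rewrite normc_def /= expr0n addr0 sqrtr_sqr. Qed.

Lemma re_norm_real (a : R) : complex.Re `|a%:C| = `|a|.
Proof. by rewrite norm_real_complex. Qed.

Lemma renormZr (V : normedModType R[i]) (a : R) (x : V) :
  renorm (a%:C *: x) = `|a| * renorm x.
Proof. by rewrite renormZ re_norm_real. Qed.

Lemma bounded_op_renorm (V : normedModType R[i]) (T : V -> V) :
  bounded_op T -> exists2 c : R, 0 <= c & forall x, renorm (T x) <= c * renorm x.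
Proof.
move=> [lT cT]; pose f := linear_of lT.
have /linear_boundedP : bounded_near f (nbhs (0 : V)).
  by apply/linear_bounded_continuous.
move=> /pinfty_ex_gt0 [r r0 fr].
exists (complex.Re r); first by move: r0; rewrite ltcE => /andP[_ /ltW].
move=> x; have := fr x; rewrite -[f x]/(T x) => h.
rewrite -lecR rmorphM /= -!renormE RRe_real // gtr0_real //.
Qed.

Lemma renorm_bounded_op (V : normedModType R[i]) (T : V -> V) (c : R) :
  linear T -> (forall x, renorm (T x) <= c * renorm x) -> bounded_op T.
Proof.
move=> lT Tc; split=> //; pose f := linear_of lT.
suff : continuous f by [].
apply/linear_bounded_continuous/linear_boundedP.
near=> r => x; rewrite -[f x]/(T x).
apply: (@le_trans _ _ (c%:C * `|x|)).
  by rewrite !renormE -rmorphM /= lecR.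
apply: ler_wpM2r => //; near: r.
by apply: nbhs_pinfty_ge; apply/complex_realP; exists c.
Unshelve. all: by end_near. Qed.

Lemma opnorm_le (V : normedModType R[i]) (T : V -> V) (c : R) : 0 <= c ->
  (forall x, renorm (T x) <= c * renorm x) -> opnorm T <= c.
Proof.
move=> c0 Tc; apply: ge_sup.
  by exists (renorm (T 0)); exists 0; rewrite //= normr0.
move=> _ [x /= x1 <-]; apply: le_trans (Tc x) _.
by rewrite ler_piMr // -lecR -renormE.
Qed.

Lemma opnorm_ge0 (V : normedModType R[i]) (T : V -> V) (c : R) : 0 <= c ->
  (forall x, renorm (T x) <= c * renorm x) -> 0 <= opnorm T.
Proof.
move=> c0 Tc; apply: le_trans (renorm_ge0 (T 0)) _; apply: sup_ubound.
  exists c => _ [x /= x1 <-]; apply: le_trans (Tc x) _.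
  by rewrite ler_piMr // -lecR -renormE.
by exists 0; rewrite //= normr0.
Qed.

Lemma renorm_opnorm (V : normedModType R[i]) (T : V -> V) x :
  bounded_op T -> renorm (T x) <= opnorm T * renorm x.
Proof.
move=> bT; have [lT _] := bT; have [c c0 Tc] := bounded_op_renorm bT.
have [->|x0] := eqVneq x 0.
  by have -> : T 0 = 0 := linear0 (linear_of lT); rewrite renorm0 mulr0.
have xp : 0 < renorm x.
  by rewrite lt_def renorm_ge0 andbT; apply: contra x0 => /eqP/renorm_eq0 ->.
have /= e := linearZ_LR (linear_of lT) ((renorm x)^-1)%:C x.
have : renorm (T (((renorm x)^-1)%:C *: x)) <= opnorm T.
  apply: sup_ubound.
    exists c => _ [y /= y1 <-]; apply: le_trans (Tc y) _.
    by rewrite ler_piMr // -lecR -renormE.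
  exists (((renorm x)^-1)%:C *: x) => //=.
  by rewrite renorm_le renormZr ger0_norm ?invr_ge0 ?renorm_ge0 // mulVf ?gt_eqF.
rewrite e renormZr ger0_norm ?invr_ge0 ?renorm_ge0 //.
by rewrite mulrC ler_pdivrMr.
Qed.

End ComplexOperators.

(** * Norm limits of operators *)

Section OperatorLimits.
Variables (R : realType) (F : completeNormedModType R[i]).
Implicit Types (x y : F) (P : nat -> F -> F) (tau : nat -> R).

(** The explicit rate [tau] serves both for convergence in operator norm and for passing to the
    limit in pointwise identities. *)
Definition tends_to P (T : F -> F) tau : Prop :=
  [/\ tau @ \oo --> (0 : R), forall N, 0 <= tau N &
      forall N x, renorm (T x - P N x) <= tau N * renorm x].

Lemma cvg0_small tau (y c : R) : tau @ \oo --> (0 : R) ->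
  (forall N, `|y| <= tau N * c) -> y = 0.
Proof.
move=> tau0 yc; apply/eqP; rewrite -normr_le0.
have h : (fun N => tau N * c) @ \oo --> (0 : R).
  by rewrite -[X in _ --> X](mul0r c); apply: cvgMl.
rewrite -(cvg_lim (@Rhausdorff R) h); apply: limr_ge; first by apply/cvg_ex; exists 0.
by near=> N; apply: yc.
Unshelve. all: by end_near. Qed.

Lemma sequence_limit (u : nat -> F) (a : nat -> R) (M : R) :
  (forall n, 0 <= a n) -> (forall n, renorm (u n.+1 - u n) <= a n) ->
  (forall N, \sum_(n < N) a n <= M) ->
  exists l, forall N, renorm (l - u N) <= limn (series a) - series a N.
Proof.
move=> a0 ua aM.
have nda : nondecreasing_seq (series a) by exact: nondecreasing_series.
have ca : cvgn (series a).
  apply: nondecreasing_is_cvgn => //; exists M => _ [n _ <-].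
  by rewrite /series /= big_mkord.
pose v n := u n.+1 - u n.
have seriesv N : series v N = u N - u 0 by rewrite /series /= telescope_sumr.
have sum_le m n : renorm (\sum_(m <= k < n) v k) <= \sum_(m <= k < n) a k.
  by apply: le_trans (renorm_sum _ _ _) _; apply: ler_sum => k _; apply: ua.
have cv : cvgn (series v).
  apply/cauchy_cvgP/cauchy_seriesP => e e0.
  have re0 : 0 < complex.Re e by move: e0; rewrite ltcE => /andP[].
  move/cauchy_cvgP/cauchy_seriesP: ca => /(_ _ re0); apply: filterS => -[m n] /= h.
  rewrite renormE -[e]RRe_real ?gtr0_real // ltcR.
  by apply: le_lt_trans (sum_le m n) _; apply: le_lt_trans (ler_norm _) h.
exists (limn (series v) + u 0) => N.
apply/ler_addgt0Pr => eps eps0.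
have eps0C : 0 < eps%:C by rewrite ltcR.
have /cvgrPdist_le /(_ _ eps0C) [m _ Hm] := cv.
have := Hm (N + m)%N (leq_addl _ _); rewrite renorm_le seriesv => h.
have -> : limn (series v) + u 0 - u N
  = (limn (series v) - (u (N + m)%N - u 0)) + (u (N + m)%N - u N).
  by rewrite opprB !addrA subrK.
apply: le_trans (renormD _ _) _; rewrite addrC; apply: lerD => //.
have -> : u (N + m)%N - u N = \sum_(N <= k < N + m) v k by rewrite telescope_sumr ?leq_addr.
apply: le_trans (sum_le _ _) _.
rewrite lerBrDl -(sub_series_geq a (leq_addr m N)) addrC subrK.
exact: nondecreasing_cvgn_le.
Qed.

Lemma operator_limit P (a : nat -> R) (M : R) :
  (forall n, linear (P n)) -> (forall x, P 0 x = 0) -> (forall n, 0 <= a n) ->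
  (forall n x, renorm (P n.+1 x - P n x) <= a n * renorm x) ->
  (forall N, \sum_(n < N) a n <= M) ->
  exists T tau, bounded_op T /\ tends_to P T tau.
Proof.
move=> lP P0 a0 Pa aM.
pose tau N := limn (series a) - series a N.
have nda : nondecreasing_seq (series a) by exact: nondecreasing_series.
have ca : cvgn (series a).
  apply: nondecreasing_is_cvgn => //; exists M => _ [n _ <-].
  by rewrite /series /= big_mkord.
have tau0 : tau @ \oo --> (0 : R).
  by rewrite -[X in _ --> X](subrr (limn (series a))); apply: cvgB => //; exact: cvg_cst.
have tau_ge0 N : 0 <= tau N by rewrite subr_ge0; exact: nondecreasing_cvgn_le.
have H x : exists l, forall N, renorm (l - P N x) <= tau N * renorm x.
  have [n|n|N|l hl] := @sequence_limit (fun n => P n x) (fun n => a n * renorm x) (M * renorm x).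
  - by rewrite mulr_ge0 ?renorm_ge0.
  - exact: Pa.
  - by rewrite -mulr_suml ler_wpM2r ?renorm_ge0.
  exists l => N; apply: le_trans (hl N) _; rewrite /tau.
  have e n : series (fun n => a n * renorm x) n = series a n * renorm x.
    by rewrite /series /= mulr_suml.
  have -> : limn (series (fun n => a n * renorm x)) = limn (series a) * renorm x.
    apply/cvg_lim => //.
    have -> : series (fun n => a n * renorm x) = (fun n => series a n * renorm x).
      by apply/funext.
    exact: cvgMl.
  by rewrite e mulrBl.
have [T HT] := choice H; exists T, tau.
have TP : tends_to P T tau by [].
split=> //; apply: (@renorm_bounded_op _ _ _ (tau 0)); last first.
  by move=> x; have := HT x 0; rewrite P0 subr0.
move=> c x y; apply/eqP; rewrite -subr_eq0; apply/eqP/renorm_eq0.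
pose K := renorm (c *: x + y) + complex.Re `|c| * renorm x + renorm y.
apply: (cvg0_small (c := K) tau0) => N; rewrite ger0_norm ?renorm_ge0 //.
have -> : T (c *: x + y) - (c *: T x + T y) =
  (T (c *: x + y) - P N (c *: x + y)) - c *: (T x - P N x) - (T y - P N y).
  by rewrite lP scalerBr -addrA -opprD addrACA -opprD opprB addrA subrK.
apply: le_trans (renormB _ _) _; rewrite /K !mulrDr; apply: lerD => //.
apply: le_trans (renormB _ _) _; apply: lerD => //.
rewrite renormZ mulrCA ler_wpM2l //.
by rewrite -ler0c RRe_real // ger0_real.
Qed.

Lemma tends_to_opnorm P T tau : tends_to P T tau ->
  (fun N => opnorm (fun x => T x - P N x)) @ \oo --> (0 : R).
Proof.
move=> [tau0 tau_ge0 TP]; apply: (squeeze_cvgr _ (cvg_cst 0) tau0).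
near=> N; apply/andP; split; first exact: (opnorm_ge0 (tau_ge0 N)).
exact: opnorm_le.
Unshelve. all: by end_near. Qed.

Lemma tends_to_comm P T tau S : tends_to P T tau -> bounded_op S ->
  (forall N x, S (P N x) = P N (S x)) -> S \o T = T \o S.
Proof.
move=> [tau0 tau_ge0 TP] bS SP; apply/funext => x /=.
have [c c0 Sc] := bounded_op_renorm bS; have [lS _] := bS.
apply/eqP; rewrite -subr_eq0; apply/eqP/renorm_eq0.
apply: (cvg0_small (c := c * renorm x + renorm (S x)) tau0) => N.
rewrite ger0_norm ?renorm_ge0 //.
have -> : S (T x) - T (S x) = S (T x - P N x) - (T (S x) - P N (S x)).
  have /= -> := linearB (linear_of lS) (T x) (P N x).
  by rewrite SP opprB addrA subrK.
apply: le_trans (renormB _ _) _; rewrite mulrDr; apply: lerD => //.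
by apply: le_trans (Sc _) _; rewrite mulrCA ler_wpM2l.
Qed.

End OperatorLimits.

Section CastReal.
Variables (R : realType) (d : nat) (q : R).
Implicit Types (f : word d -> R^o) (i j : 'I_d) (u v w : word d).

Lemma lann_real j f w : lann q%:C j (fun v => (f v)%:C : R[i]^o) w = (lann q j f w)%:C.
Proof.
elim: w f => [|a w IH] f //=.
by rewrite IH rmorphD rmorphMn rmorphM.
Qed.

Lemma moment_real u f : moment q%:C u (fun v => (f v)%:C : R[i]^o) = (moment q u f)%:C.
Proof.
elim: u f => [|j u IH] f //=; rewrite -IH; congr (moment _ u _).
by apply/funext => w; rewrite /gauss lann_real -rmorphD.
Qed.

End CastReal.

Section WordDelta.
Variables (R : realType) (d : nat).

Definition word_delta (w : word d) : wordcomb R d := [fsfun [fsfun] with w |-> 1]%fset.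

Lemma finsupp_delta w : finsupp (word_delta w) = [fset w]%fset.
Proof. by rewrite finsupp_with oner_eq0 finsupp0 fsetU0. Qed.

Lemma word_deltaE w : word_delta w w = 1.
Proof. by rewrite fsfun_with. Qed.

Lemma lincomb_delta (V : lmodType R[i]) w (v : word d -> V) :
  lincomb (word_delta w) v = v w.
Proof. by rewrite /lincomb finsupp_delta big_seq_fset1 word_deltaE scale1r. Qed.

End WordDelta.

(** * Geometry of the inner product *)

Section InnerProduct.
Variables (R : realType) (F : normedModType R[i]) (dot : {dot F for Num.conj}).
Hypothesis dotn : induces_norm dot.
Implicit Types x y z : F.

Lemma dotC x y : dot x y = Num.conj (dot y x).
Proof. by rewrite hermC expr0 mul1r. Qed.

Lemma conj_real (r : R) : Num.conj (r%:C) = r%:C.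
Proof. by apply/CrealP/complex_realP; exists r. Qed.

Lemma dot_linear z : linear (fun x => dot x z : R[i]^o).
Proof. by move=> a x y; rewrite linearDl linearZl_LR. Qed.

Lemma dotBl x y z : dot (x - y) z = dot x z - dot y z.
Proof. exact: linearBl. Qed.

Lemma dotxx x : dot x x = (renorm x ^+ 2)%:C.
Proof. by rewrite -dotn renormE rmorphXn. Qed.

Lemma cauchy_schwarz x y : `|dot x y| <= (renorm x * renorm y)%:C.
Proof.
have [->|y0] := eqVneq y 0.
  by rewrite linear0r normr0 ler0c mulr_ge0 ?renorm_ge0.
have n0 : 0 < renorm y.
  by rewrite lt_def renorm_ge0 andbT; apply: contra y0 => /eqP/renorm_eq0 ->.
set n := renorm y in n0 *; set a := dot x y.
pose z := (n ^+ 2)%:C *: x - a *: y.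
have zy : dot z y = 0.
  by rewrite /z linearBl !linearZl_LR /= dotxx -/n mulrC subrr.
have zx : dot z x = (n ^+ 2)%:C * (renorm x ^+ 2)%:C - `|a| ^+ 2.
  by rewrite /z linearBl !linearZl_LR /= dotxx (dotC y x) normCK.
have zz : dot z z = (n ^+ 2)%:C * dot z x.
  by rewrite {2}/z linearBr !linearZr_LR /= zy mulr0 subr0 conj_real.
have : 0 <= dot z z by rewrite dotxx ler0c sqr_ge0.
rewrite zz pmulr_rge0; last by rewrite ltcR exprn_gt0.
rewrite zx subr_ge0 -rmorphM /= -exprMn mulrC rmorphXn /=.
by rewrite ler_pXn2r ?nnegrE // ler0c mulr_ge0 ?renorm_ge0 // ltW.
Qed.

Lemma dense_orthogonal (S : set F) x : dense S -> (forall y, S y -> dot x y = 0) -> x = 0.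
Proof.
move=> dS Sx; apply/eqP; apply/negP => /negP x0.
have nx : 0 < renorm x.
  by rewrite lt_def renorm_ge0 andbT; apply: contra x0 => /eqP/renorm_eq0 ->.
have [||y [xy Sy]] := dS (ball x (renorm x)%:C).
- by exists x; apply: ballxx; rewrite ltcR.
- by apply: ball_open; rewrite ltcR.
move: xy; rewrite -ball_normE /ball_ /= renormE ltcR => xy.
have h : dot (x - y) (x - y) = dot x x + dot y y.
  by rewrite linearBl !linearBr /= (dotC y x) (Sx y Sy) conjC0 /= !subr0 sub0r opprK.
have : (renorm x ^+ 2)%:C <= (renorm (x - y) ^+ 2)%:C.
  by rewrite -!dotxx h lerDl dotxx ler0c sqr_ge0.
rewrite lecR ler_pXn2r ?nnegrE ?renorm_ge0 // leNgt.
by move/negP.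
Qed.

End InnerProduct.

(** * The q-Gaussians on the completed Fock space *)

Section FockSpace.
Variables (R : realType) (d : nat) (q : R) (F : completeNormedModType R[i]).
Variables (dot : {dot F for Num.conj}) (e : word d -> F).
Hypothesis Fock : is_q_Fock q dot e.
Implicit Types (i j : 'I_d) (u v w : word d).

Let dotn : induces_norm dot. Proof. by case: Fock. Qed.

Lemma dot_gram w v : dot (e w) (e v) = (gram q w v)%:C.
Proof.
have [_ H _] := Fock.
have := H (word_delta R w) (word_delta R v); rewrite !lincomb_delta => ->.
rewrite /q_inner finsupp_delta big_seq_fset1 word_deltaE mul1r.
rewrite /q_symmetrize finsupp_delta big_seq_fset1 word_deltaE mul1r.
by rewrite -perm_word_gram -rmorph_sum conj_real.
Qed.

Lemma basis_orthogonal x : (forall w, dot x (e w) = 0) -> x = 0.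
Proof.
move=> xe; have [_ _ De] := Fock; apply: (dense_orthogonal dotn De) => _ [p _ <-].
by rewrite /lincomb linear_sumr big1 // => w _; rewrite linearZr_LR /= xe mulr0.
Qed.

Variable A : 'I_d -> F -> F.
Hypothesis qGauss : q_Gaussians dot e A.

Lemma q_Gaussian_bounded i : bounded_op (A i).
Proof.
have [l [ls [[bl bls] _ _ ->]]] := qGauss i.
have [c _ hc] := bounded_op_renorm bl; have [c' _ hc'] := bounded_op_renorm bls.
apply: (@renorm_bounded_op _ _ _ (c + c')) => [a x y|x] /=.
  by rewrite bl.1 bls.1 scalerDr addrACA.
by apply: le_trans (renormD _ _) _; rewrite mulrDl lerD.
Qed.

Lemma q_Gaussian_selfadjoint i x y : dot (A i x) y = dot x (A i y).
Proof.
have [l [ls [_ _ lls ->]]] := qGauss i.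
rewrite /= linearDl linearDr /= lls addrC; congr (_ + _).
by rewrite dotC -lls -dotC.
Qed.

(** The family [e] plays the identity of the Fock space, so [gauss] computes vectors here. The
    operator [l] is known only as an adjoint; its values are found by pairing with every [e v]. *)
Lemma q_Gaussian_basis i w : A i (e w) = gauss q%:C i e w.
Proof.
have [l [ls [_ lse lls ->]]] := qGauss i.
rewrite /= lse addrC /gauss; congr (_ + _).
apply/eqP; rewrite -subr_eq0; apply/eqP/basis_orthogonal => v.
rewrite dotBl lls lse dot_gram gram_cons -lann_real.
have /= <- := lann_linear q%:C (linear_of (dot_linear dot (e v))) i e w.
apply/eqP; rewrite subr_eq0; apply/eqP; apply: eq_lann => x _.
by rewrite dot_gram.
Qed.

Lemma monomial_vacuum u : monomial A u (e [::]) = moment q%:C u e.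
Proof.
elim: u => //= j u ->.
have /= <- := moment_linear q%:C (linear_of (q_Gaussian_bounded j).1) u e.
by congr (moment _ u _); apply/funext => w; rewrite q_Gaussian_basis.
Qed.

Lemma dot_monomial_vacuum u z :
  dot (monomial A u (e [::])) z = moment q%:C u (fun w => dot (e w) z : R[i]^o).
Proof.
rewrite monomial_vacuum.
by have /= -> := moment_linear q%:C (linear_of (dot_linear dot z)) u e.
Qed.

Lemma dot_monomial_basis u y :
  dot (monomial A u (e [::])) (e y) = (moment q u (fun w => gram q w y))%:C.
Proof.
rewrite dot_monomial_vacuum -moment_real; congr (moment _ u _).
by apply/funext => w; rewrite dot_gram.
Qed.

Lemma tau_monomial u : tau dot e (monomial A u) = (moment q u (vacuum_coef R (d:=d)))%:C.
Proof.
rewrite /tau /vacuum dot_monomial_basis; congr (_ %:C); congr (moment _ u _).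
by apply/funext => w; rewrite gramC.
Qed.

Lemma monomial_adjoint u x y : dot (monomial A u x) y = dot x (monomial A (rev u) y).
Proof.
elim: u x y => [|j u IH] x y //=.
rewrite q_Gaussian_selfadjoint IH rev_cons.
have -> : monomial A (rcons (rev u) j) y = monomial A (rev u) (A j y).
  by elim: (rev u) => //= k v ->.
by [].
Qed.

End FockSpace.

(** * Cyclic derivatives and rotations of words *)

Section CyclicSums.
Variables (K : comNzRingType) (d : nat) (V : lmodType K).
Implicit Types (i : 'I_d) (u v w : word d).

Lemma free_diff_sum i w (h : word d -> word d -> V) :
  \sum_(p <- free_diff i w) h p.1 p.2 = split_sum i h w.
Proof.
elim: w h => [|a w IH] h /=; first by rewrite big_nil.
rewrite big_cat big_map /= -(IH (fun u v => h (a :: u) v)); congr (_ + _).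
by case: (a == i); rewrite ?big_seq1 ?big_nil.
Qed.

Lemma split_sum_rev i (h : word d -> word d -> V) w :
  split_sum i h (rev w) = split_sum i (fun x y => h (rev y) (rev x)) w.
Proof.
elim: w h => [|a w IH] h //=.
rewrite rev_cons split_sum_rcons IH addrC; congr (_ + _).
by apply: eq_split_sum => u v _; rewrite rev_cons.
Qed.

Definition head_sum i (h : word d -> V) w : V :=
  if w is a :: u then h u *+ (a == i) else 0.

(** The middle word [z] accumulates the letters already passed, as the induction requires; the case
    of interest is [z] empty. *)
Lemma split_sum_cycle i (h : word d -> V) z w :
  split_sum i (fun x y => h (y ++ z ++ x)) w =
  \sum_(k < size w) head_sum i h (drop k w ++ z ++ take k w).
Proof.
elim: w z => [|a w IH] z /=; first by rewrite big_ord0.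
rewrite big_ord_recl /= cats0; congr (_ + _).
transitivity (split_sum i (fun x y => h (y ++ rcons z a ++ x)) w).
  by apply: eq_split_sum => x y _; rewrite cat_rcons.
by rewrite IH; apply: eq_bigr => k _; rewrite /= add0n cat_rcons.
Qed.

Lemma cyc_diff_sum i (h : word d -> V) w :
  \sum_(u <- cyc_diff i w) h u = \sum_(k < size w) head_sum i h (rot k w).
Proof.
rewrite /cyc_diff big_map (free_diff_sum i w (fun x y => h (y ++ x))).
exact: (split_sum_cycle i h [::] w).
Qed.

Lemma rot_invariant (T : Type) (b : word d -> T) k w :
  (forall u, b (rot 1 u) = b u) -> b (rot k w) = b w.
Proof.
move=> bE; have [kw|wk] := leqP k (size w); last by rewrite rot_oversize // ltnW.
by elim: k kw => [|k IH] kw; rewrite ?rot0 // rotS // bE IH // ltnW.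
Qed.

(** [\mathcal{D}_i x^w] beheads the rotations of [w] that start with [i]. For rotation invariant [b]
    all [n + 1] rotations contribute equally, which explains the division by the length in the
    potential. *)
Lemma lsum_cyc_diff n i (b : word d -> K) (h : word d -> V) :
  (forall u, b (rot 1 u) = b u) ->
  lsum n.+1 (fun w => b w *: \sum_(u <- cyc_diff i w) h u) =
  lsum n (fun u => b (i :: u) *: h u) *+ n.+1.
Proof.
move=> bE.
transitivity (\sum_(k < n.+1) lsum n.+1 (fun w => b (rot k w) *: head_sum i h (rot k w))).
  rewrite /lsum exchange_big; apply: eq_bigr => w _ /=.
  rewrite cyc_diff_sum size_tuple scaler_sumr; apply: eq_bigr => k _.
  by rewrite (rot_invariant k w bE).
rewrite (eq_bigr (fun _ => lsum n (fun u => b (i :: u) *: h u))); last first.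
  move=> k _; rewrite (lsum_rot _ k (fun w => b w *: head_sum i h w)) lsumS.
  rewrite (bigD1 i) //= eqxx big1 ?addr0 // => j ji.
  by rewrite /lsum big1 // => u _; rewrite (negbTE ji) mulr0n scaler0.
by rewrite sumr_const card_ord.
Qed.

End CyclicSums.

Section Summability.
Variables (R : realType) (d : nat).

Lemma wsum_summable (g : word d -> R) (M : R) : (forall w, 0 <= g w) ->
  (forall N, wsum N g <= M) -> summable [set: word d] (fun w => (g w)%:E).
Proof.
move=> g0 gM; rewrite /summable; apply: (@le_lt_trans _ _ M%:E); last exact: ltry.
apply: ge_ereal_sup => _ [X [finX _] <-].
rewrite fsbig_finite //= (eq_bigr (fun x => (g x)%:E)); last by move=> x _; rewrite /= ger0_norm.
rewrite sumEFin lee_fin; pose N := (\max_(x <- fset_set X) size x).+1.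
apply: le_trans (gM N).
rewrite (eq_big_seq (fun x => wsum N (fun w => g w *+ (x == w)))); last first.
  by move=> x xX; rewrite wsum_delta // ltnS; apply: leq_bigmax_seq.
rewrite /wsum /lsum exchange_big; apply: ler_sum => n _.
rewrite exchange_big; apply: ler_sum => w _ /=.
rewrite sumrMnr; set c := (\sum_(_ <- _) _)%N.
have : (c <= 1)%N.
  rewrite /c (eq_bigr (fun x => if x == w :> word d then 1 else 0)%N) => [|x _]; last by case: ifP.
  by rewrite -big_mkcond sum1_count count_uniq_mem ?fset_uniq // leq_b1.
by case: c => [|[|c]] // _; rewrite ?mulr0n ?mulr1n.
Qed.

End Summability.

(** * Power series in bounded operators *)

Section PowerSeries.
Variables (R : realType) (d : nat) (F : completeNormedModType R[i]).
Variables (dot : {dot F for Num.conj}) (A : 'I_d -> F -> F).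
Hypothesis bA : forall i, bounded_op (A i).
Implicit Types (i j : 'I_d) (u v w : word d) (c : word d -> R).

Let r : R := \big[Num.max/0]_(i < d) opnorm (A i) + 1.

Let r_ge1 : 1 <= r.
Proof. by rewrite lerDr bigmax_ge_id. Qed.

Let r_ge0 : 0 <= r := le_trans ler01 r_ge1.

Definition poly_sum c N (x : F) : F := wsum N (fun u => (c u)%:C *: monomial A u x).

Lemma bounded_monomial_linear u : linear (monomial A u).
Proof. by elim: u => [|j u IH] a x y //=; rewrite IH (bA j).1. Qed.

Lemma monomial_bound u x : renorm (monomial A u x) <= r ^+ size u * renorm x.
Proof.
elim: u => [|j u IH] /=; first by rewrite expr0 mul1r.
apply: le_trans (renorm_opnorm _ (bA j)) _; rewrite exprS -mulrA.
apply: ler_pM => //; try exact: renorm_ge0.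
  have [c c0 hc] := bounded_op_renorm (bA j); exact: opnorm_ge0 c0 hc.
by apply: le_trans (le_bigmax 0 (fun i => opnorm (A i)) j) _; rewrite lerDl.
Qed.

Lemma poly_sum_linear c N : linear (poly_sum c N).
Proof.
move=> a x y; rewrite /poly_sum /wsum scaler_sumr -big_split; apply: eq_bigr => n _.
rewrite /lsum scaler_sumr -big_split; apply: eq_bigr => u _ /=.
by rewrite bounded_monomial_linear scalerDr !scalerA mulrC.
Qed.

Lemma power_series_limit c (M : R) :
  (forall N, wsum N (fun u => `|c u| * r ^+ size u) <= M) ->
  exists T tau, bounded_op T /\ tends_to (poly_sum c) T tau.
Proof.
move=> cM; apply: (@operator_limit _ _ _ (fun n => lsum n (fun u => `|c u| * r ^+ size u)) M).
- exact: poly_sum_linear.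
- by move=> x; rewrite /poly_sum /wsum big_ord0.
- by move=> n; apply: sumr_ge0 => u _; rewrite mulr_ge0 // exprn_ge0.
- move=> n x; rewrite /poly_sum wsumSr addrAC subrr add0r.
  apply: le_trans (renorm_sum _ _ _) _; rewrite /lsum mulr_suml; apply: ler_sum => u _.
  by rewrite renormZr -mulrA ler_wpM2l // monomial_bound.
- exact: cM.
Qed.

Lemma power_series_vN c T tau : bounded_op T -> tends_to (poly_sum c) T tau ->
  vN_generated dot (range A) T.
Proof.
move=> bT cT; split=> // S [bS HS].
have SA i x : S (A i x) = A i (S x).
  by have := HS (A i) (or_introl (ex_intro2 _ _ i I erefl)) => /(congr1 (@^~ x)).
have SM u x : S (monomial A u x) = monomial A u (S x).
  by elim: u => //= j u <-; rewrite SA.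
apply/esym; apply: (tends_to_comm cT bS) => N x.
transitivity (linear_of bS.1 (poly_sum c N x)) => //.
rewrite /poly_sum /wsum raddf_sum; apply: eq_bigr => n _.
rewrite /lsum raddf_sum; apply: eq_bigr => u _.
rewrite -SM; exact: (linearZ_LR (linear_of bS.1)).
Qed.

Lemma power_series_op c T tau : bounded_op T -> tends_to (poly_sum c) T tau ->
  op_series (fun w => (c w)%:C) (monomial A) T.
Proof. by move=> bT cT; split=> //; exact: tends_to_opnorm cT. Qed.

Lemma power_series_convergent c (M : R) :
  (forall N, wsum N (fun u => `|c u| * r ^+ size u) <= M) ->
  convergent_series A (fun w => (c w)%:C).
Proof.
move=> cM; exists r; first by rewrite ltrDl.
have -> : (fun w => (complex.Re `|(c w)%:C| * r ^+ size w)%:E)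
  = (fun w => (`|c w| * r ^+ size w)%:E).
  by apply/funext => w; rewrite re_norm_real.
by apply: wsum_summable cM => w; rewrite mulr_ge0 // exprn_ge0.
Qed.

Lemma cyclic_derivative_series (b : word d -> R) i T tau :
  (forall u, b (rot 1 u) = b u) -> bounded_op T ->
  tends_to (poly_sum (fun u => b (i :: u))) T tau ->
  cyclic_derivative A i (fun w => (b w / (size w)%:R)%:C) T.
Proof.
(* A cyclic derivative lowers the length by one, so [N + 1] degrees of the potential match [N]
   degrees of [T]; the empty word contributes nothing. *)
move=> bE bT cT; split=> //; rewrite -cvg_shiftS /=.
have -> : (fun N => opnorm (fun x => T x - \sum_(n < N.+1) \sum_(w : n.-tuple 'I_d)
     (b w / (size w)%:R)%:C *: \sum_(u <- cyc_diff i w) monomial A u x))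
  = (fun N => opnorm (fun x => T x - poly_sum (fun u => b (i :: u)) N x)).
  apply/funext => N; congr opnorm; apply/funext => x; congr (_ - _).
  rewrite big_ord_recl big1 ?add0r; last first.
    by move=> w _; rewrite tuple0 /= big_nil scaler0.
  apply: eq_bigr => n _.
  transitivity (((n.+1)%:R^-1 : R)%:C *:
      lsum n.+1 (fun w => (b w)%:C *: \sum_(u <- cyc_diff i w) monomial A u x)).
    rewrite /lsum scaler_sumr; apply: eq_bigr => w _.
    by rewrite scalerA -rmorphM /= size_tuple mulrC.
  rewrite (lsum_cyc_diff n i (b := fun w => (b w)%:C)); last by move=> u; rewrite bE.
  rewrite -[lsum _ _ *+ _]scaler_nat scalerA -[X in _ * X](rmorph_nat (real_complex R)) -rmorphM /=.
  by rewrite mulVf ?pnatr_eq0 // scale1r.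
exact: tends_to_opnorm cT.
Qed.

Lemma potential_sum_bound (b : word d -> R) (M : R) : b [::] = 0 ->
  (forall i N, wsum N (fun u => `|b (i :: u)| * r ^+ size u) <= M) ->
  forall N, wsum N (fun w => `|b w / (size w)%:R| * r ^+ size w) <= \sum_(i < d) r * `|M|.
Proof.
move=> b0 bM [|N]; first by rewrite /wsum big_ord0 sumr_ge0 // => i _; rewrite mulr_ge0.
rewrite wsumS b0 mul0r normr0 mul0r add0r; apply: ler_sum => i _.
apply: (@le_trans _ _ (r * wsum N (fun u => `|b (i :: u)| * r ^+ size u))).
  rewrite -wsumZ; apply: ler_wsum => u /=.
  rewrite exprS mulrCA ler_wpM2l // ler_wpM2r ?exprn_ge0 // normrM ler_piMr //.
  by rewrite ger0_norm ?invr_ge0 // invf_le1 ?ltr0n // ler1n.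
rewrite ler_wpM2l //; apply: le_trans (bM i N) _; exact: ler_norm.
Qed.

End PowerSeries.

(** * The conjugate system as vectors *)

Section ConjugateVectors.
Variables (R : realType) (d : nat) (q : R) (F : completeNormedModType R[i]).
Variables (dot : {dot F for Num.conj}) (e : word d -> F) (A : 'I_d -> F -> F).
Hypotheses (Fock : is_q_Fock q dot e) (qGauss : q_Gaussians dot e A).
Implicit Types (i j : 'I_d) (u v w y : word d).

Local Notation m u := (moment q u (vacuum_coef R (d:=d))).

Let dotn : induces_norm dot. Proof. by case: Fock. Qed.

Let bA i : bounded_op (A i). Proof. exact: q_Gaussian_bounded qGauss i. Qed.

Let r : R := \big[Num.max/0]_(i < d) opnorm (A i) + 1.

Lemma moment_rev u : m (rev u) = m u.
Proof.
apply: complexI; rewrite -!(tau_monomial Fock qGauss) /tau.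
rewrite (monomial_adjoint qGauss) revK [LHS]dotC.
by rewrite -/(tau dot e (monomial A u)) (tau_monomial Fock qGauss) conj_real.
Qed.

Lemma moment_gram_bound u y :
  `|moment q u (fun w => gram q w y)| <= renorm (e [::]) * renorm (e y) * r ^+ size u.
Proof.
rewrite -re_norm_real -(dot_monomial_basis Fock qGauss).
rewrite -lecR RRe_real ?ger0_real //.
apply: le_trans (cauchy_schwarz dotn _ _) _; rewrite lecR mulrAC ler_wpM2r ?renorm_ge0 //.
by rewrite mulrC; apply: monomial_bound.
Qed.

Lemma dot_poly_sum (c : word d -> R) N y :
  dot (poly_sum A c N (e [::])) (e y) =
  (wsum N (fun u => c u * moment q u (fun w => gram q w y)))%:C.
Proof.
rewrite /poly_sum /wsum linear_sumlz rmorph_sum; apply: eq_bigr => n _.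
rewrite /lsum linear_sumlz rmorph_sum; apply: eq_bigr => u _.
by rewrite linearZl_LR /= (dot_monomial_basis Fock qGauss) -rmorphM.
Qed.

(** Two errors are added: the norm distance from [T] to its partial sums, by Cauchy-Schwarz, and the
    distance of the partial sums from the dual functional, from the premise with [t] given by
    [moment_gram_bound]. *)
Lemma conjugate_vector_dot (c : word d -> R) (M : R) i T tau :
  tends_to (poly_sum A c) T tau ->
  (forall y t N, (size y < N)%N ->
     (forall u, `|moment q u (fun w => gram q w y)| <= t * r ^+ size u) ->
     `|wsum N (fun u => c u * moment q u (fun w => gram q w y))
       - dual q i (vacuum_coef R (d:=d)) y| <= t * (M * 2^-1 ^+ N)) ->
  forall y, dot (T (e [::])) (e y) = (dual q i (vacuum_coef R (d:=d)) y)%:C.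
Proof.
move=> [tau0 tau_ge0 Ttau] cM y; set phi : R := dual _ _ _ _.
pose t := renorm (e [::]) * renorm (e y).
pose sigma N := tau N * t + t * M * 2^-1 ^+ N.
have sigma0 : sigma @ \oo --> (0 : R).
  rewrite -[X in _ --> X](addr0 0); apply: cvgD.
    by rewrite -[X in _ --> X](mul0r t); apply: cvgMl.
  by apply: cvg_geometric; rewrite ger0_norm ?invr_ge0 // invf_lt1 // ltr1n.
pose D := dot (T (e [::])) (e y) - phi%:C.
have DE : `|D| = (complex.Re `|D|)%:C by rewrite RRe_real // ger0_real.
have D_ge0 : 0 <= complex.Re `|D| by rewrite -ler0c -DE.
apply/eqP; rewrite -subr_eq0 -/D -normr_eq0 DE; apply/eqP; congr (_%:C).
apply: (@cvg0_small _ (fun N => sigma (N + (size y).+1)%N) _ 1).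
  by rewrite (cvg_shiftn (size y).+1 sigma).
move=> N0; set N := (N0 + _)%N; rewrite mulr1 (ger0_norm D_ge0).
suff : `|D| <= (sigma N)%:C by rewrite DE lecR.
have yN : (size y < N)%N by rewrite /N addnS ltnS leq_addl.
rewrite /D -(subrKA (dot (poly_sum A c N (e [::])) (e y))).
apply: le_trans (ler_normD _ _) _; rewrite rmorphD /=; apply: lerD.
  rewrite -dotBl; apply: le_trans (cauchy_schwarz dotn _ _) _.
  by rewrite lecR /t mulrA ler_wpM2r ?renorm_ge0.
rewrite dot_poly_sum -rmorphB /= norm_real_complex lecR -mulrA.
by apply: cM => // u; apply: moment_gram_bound.
Qed.

(** Moving [A^w] to the other side of the inner product reverses [w], hence exchanges the two tensor
    legs and reverses each; the moments are real and invariant under reversal. *)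
Lemma dual_conjugate_system (xi : 'I_d -> F) :
  (forall i y, dot (xi i) (e y) = (dual q i (vacuum_coef R (d:=d)) y)%:C) ->
  conjugate_system dot e A xi.
Proof.
move=> xiE Q i; rewrite /poly_op /lincomb /tau2_diff linear_sumlz.
apply: eq_bigr => w _; rewrite linearZl_LR /=; congr (_ * _).
rewrite (monomial_adjoint qGauss) dotC (dot_monomial_vacuum Fock qGauss).
transitivity ((moment q (rev w) (dual q i (vacuum_coef R (d:=d))))%:C).
  rewrite -[RHS]conj_real -moment_real; congr (Num.conj _).
  by congr (moment _ _ _); apply/funext => v; rewrite dotC xiE conj_real.
rewrite moment_dual split_sum_rev.
rewrite (eq_split_sum i (h' := fun x y => m x * m y)); last first.
  by move=> x y _; rewrite !moment_rev mulrC.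
rewrite -free_diff_sum rmorph_sum; apply: eq_bigr => p _.
by rewrite rmorphM !(tau_monomial Fock qGauss).
Qed.

(** The difference is orthogonal to every [A^u e_0], hence by [moment_inj] to every [e v]. *)
Lemma conjugate_system_unique (xi xi' : 'I_d -> F) :
  conjugate_system dot e A xi -> conjugate_system dot e A xi' -> xi = xi'.
Proof.
move=> cxi cxi'; apply/funext => i; apply/eqP; rewrite -subr_eq0; apply/eqP.
set z := _ - _.
have zM u : dot z (monomial A u (e [::])) = 0.
  have := cxi (word_delta R (rev u)) i; rewrite -(cxi' (word_delta R (rev u)) i).
  rewrite /poly_op !lincomb_delta !(monomial_adjoint qGauss) revK => e0.
  by rewrite /z dotBl e0 subrr.
apply: (basis_orthogonal Fock) => v; rewrite dotC.
have -> : dot (e v) z = 0.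
  apply: (moment_inj (q := q%:C) (n := size v) (f := fun w => dot (e w) z : R[i]^o)
    (g := fun _ => 0)) => // u _.
  by rewrite -(dot_monomial_vacuum Fock qGauss) moment0 dotC zM conjC0.
by rewrite conjC0.
Qed.

End ConjugateVectors.

Theorem proposition6p2 (R : realType) (d : nat) (q : R)
    (F : completeNormedModType R[i]) (dot : {dot F for Num.conj})
    (e : word d -> F) (A : 'I_d -> F -> F) :
  -1 < q -> q < 1 ->
  is_q_Fock q dot e ->
  q_Gaussians dot e A ->
  exists2 xi : 'I_d -> F, unique (conjugate_system dot e A) xi &
  exists2 X : 'I_d -> F -> F,
    (forall i, vN_generated dot (range A) (X i) /\ X i (vacuum e) = xi i) &
    exists V : F -> F, free_Gibbs_potential dot A X V.
Proof.
move=> q_gt q_lt Fock qGauss.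
have q1 : `|q| < 1 by rewrite ltr_norml q_gt.
have bA := q_Gaussian_bounded qGauss.
(* The added 1 gives a radius strictly above all norms, as [convergent_series] asks, and at least
   1. *)
pose r : R := \big[Num.max/0]_(i < d) opnorm (A i) + 1.
have r1 : 1 <= r by rewrite lerDr bigmax_ge_id.
have [b [M [b0 b_rot b_sum b_dual]]] := cyclic_conjugate_coefs d q1 r1.
have HX i : exists p : (F -> F) * (nat -> R),
    bounded_op p.1 /\ tends_to (poly_sum A (fun u => b (i :: u))) p.1 p.2.
  by have [T [tau H]] := power_series_limit bA (b_sum i); exists (T, tau).
have [X hX] := choice HX.
pose xi i := (X i).1 (e [::]).
have xi_dual i y := conjugate_vector_dot Fock qGauss (hX i).2 (b_dual i) y.
have xi_conj : conjugate_system dot e A xi := dual_conjugate_system Fock qGauss xi_dual.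
exists xi; first by split=> // xi'; apply: conjugate_system_unique Fock qGauss _ _ xi_conj.
exists (fun i => (X i).1).
  by move=> i; split=> //; exact: (power_series_vN dot (hX i).1 (hX i).2).
have Vsum := potential_sum_bound b0 b_sum.
have [V [tau [bV Vtau]]] := power_series_limit bA Vsum.
exists V; split; first exact: (power_series_vN dot bV Vtau).
exists (fun w => (b w / (size w)%:R)%:C).
  by split; [exact: (power_series_convergent Vsum) | exact: (power_series_op bV Vtau)].
by move=> i; exact: (cyclic_derivative_series b_rot (hX i).1 (hX i).2).
Qed.
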